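(* Let $r,n\ge1$ be integers, let $\alpha\in\mathbb F_{2^r}^\times$, and let $C_{2,\alpha}$ be the curve $y^2+y=\alpha(x^{2^{r+1}+1}+x^{2^r+2})$ over $\mathbb F_{2^r}$. If $r$ is odd, then $$\#C_{2,\alpha}(\mathbb F_{2^{rn}})=\begin{cases}(2^{rn}+1)+2^{r(n+1)/2}&\text{if } n\equiv1,7\pmod 8,\\(2^{rn}+1)-2^{r(n+1)/2}&\text{if } n\equiv3,5\pmod 8,\\(2^{rn}+1)+2^{r(n+2)/2}&\text{if } n\equiv2,6\pmod 8,\\2^{rn}+1&\text{if } n\equiv4\pmod 8,\\(2^{rn}+1)-2^{r(n+2)/2+1}&\text{if } n\equiv0\pmod 8.\end{cases}$$ If $r$ is even and $\alpha\in\{x^3: x\in\mathbb F_{2^r}\}$, then $$\#C_{2,\alpha}(\mathbb F_{2^{rn}})=\begin{cases}(2^{rn}+1)+2^{r(n+1)/2}&\text{if } n\equiv1,3\pmod 4,\\(2^{rn}+1)+2^{r(n+2)/2}&\text{if } n\equiv2\pmod 4,\\(2^{rn}+1)-2^{r(n+2)/2+1}&\text{if } n\equiv0\pmod 4.\end{cases}$$ If $r$ is even and $\alpha\notin\{x^3: x\in\mathbb F_{2^r}\}$, then $$\#C_{2,\alpha}(\mathbb F_{2^{rn}})=\begin{cases}(2^{rn}+1)+2^{r(n+1)/2}&\text{if }\gcd(n,6)=1,\\(2^{rn}+1)+2^{r(n+2)/2}&\text{if }\gcd(n,6)=2,\\(2^{rn}+1)-2^{r(n+1)/2+1}&\text{if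 }\gcd(n,6)=3,\\(2^{rn}+1)-2^{r(n+2)/2+1}&\text{if }\gcd(n,6)=6.\end{cases}$$
   Context: $\#C_{2,\alpha}(\mathbb F_{2^{rn}})$ is the number of affine solutions $(x,y)\in\mathbb F_{2^{rn}}^2$ of the equation plus one (for the single point at infinity). *)

(* Defs.v *)
From mathcomp Require Import all_boot all_order all_algebra.

Set Implicit Arguments.
Unset Strict Implicit.
Unset Printing Implicit Defensive.

Import GRing.Theory.
Local Open Scope ring_scope.

(* The extension K of F is given by a field embedding iota : F -> K, so that
   iota alpha is alpha viewed in K. *)
Definition C2_affine (r : nat) (F K : finFieldType) (iota : {rmorphism F -> K})
    (alpha : F) : {set K * K} :=
  [set p : K * K |
    p.2 ^+ 2 + p.2
      == iota alpha * (p.1 ^+ (2 ^ (r + 1) + 1)%N + p.1 ^+ (2 ^ r + 2)%N)].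

(* The extra one is the single point at infinity. *)
Definition C2_count (r : nat) (F K : finFieldType) (iota : {rmorphism F -> K})
    (alpha : F) : nat :=
  (#|C2_affine r iota alpha| + 1)%N.

(* Main.v *)
Require Import Defs.
From HB Require Import structures.
From mathcomp Require Import all_boot all_order all_algebra.
From mathcomp Require Import all_fingroup all_solvable all_field.
From mathcomp Require Import ring zify.

Set Implicit Arguments.
Unset Strict Implicit.
Unset Printing Implicit Defensive.

Import Order.TTheory GRing.Theory Num.Theory.
Local Open Scope ring_scope.

(** Let q = 2^r, sigma x = x^q, and let K be the field of 2^(rn) elements.
Write psi a = 1 or -1 according as y^2 + y = a is solvable in K or not; psi is
the additive character of K of order two.  A point x carries 1 + psi (Q x)
solutions y, with Q x = alpha (x sigma(x)^2 + x^2 sigma(x)), so the affine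
curve has 2^(rn) + S points, where S is the sum of psi (Q x) over K.

Each monomial of Q is a product of two Frobenius powers of x, so psi o Q is a
quadratic character: S is a quadratic Gauss sum over F_2.  Hence
S^2 = |K| * (sum of psi o Q over the radical W), which is 0 or |K| |W|
[sqr_sum_quadratic, sum_radical].  Moving Frobenius powers around inside psi
shows W = {y : alpha w^4 = w for w = sigma^2 y + y} [chi_polar, radicalP].
The solutions w form {0} or a line over F_4, so |W| is |Fix sigma^2| or four
times that; the second happens exactly when the solutions w exist in K and lie
in the image of sigma^2 + 1.  This gives |S|, and the sign remains.

- If r is even, sigma fixes F_4, and multiplication by a primitive cube root of
unity preserves Q.  Its orbits on K minus 0 have length three, so S = 1 modulo
3 [cubic_sum_mod3].  In particular S does not vanish, and as 4 = 1 modulo 3 the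
congruence selects the sign.  Whether alpha is a cube governs |W|.

- If r is odd, alpha is the cube of an element of F_q, and rescaling x reduces
to alpha = 1.

When n is odd, |W| = q.  For a prime l and kl | n, the orbits of sigma^k on the
field of q^(kl) elements have length 1 or l, so the sums over the fields of
q^(kl) and q^k elements agree modulo l [cubic_sum_orbit].  Since 2^((l-1)/2) is
(2/l) modulo l, induction over the prime factors of n shows that the sign is
the Jacobi symbol (2/n) [cubic_sum_odd].

When n = 2m, let M be the field of q^m elements and theta in K with
sigma^m theta = theta + 1.  The space U = M + theta F_q is totally isotropic, so
S is also the sum of psi o Q over the orthogonal of U [sum_isotropic].  If m is
odd, U is its own orthogonal and S = |U|.  If m is a multiple of 4, the
orthogonal consists of four cosets of U, represented by theta k for k in
{0, om, t, t^2}, where t generates F_16 and om = t^2 + t generates F_4; psi o Q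
is 1 on the first and -1 on the others, so S = -2 |U| [cubic_sum_negative].
If m is 2 modulo 4, the element om t of the radical has psi (Q (om t)) = -1,
and S = 0 [cubic_sum_vanishes]. *)

(** * Quadratic characters of finite abelian groups *)

Section CharacterSums.

Variables (V : finZmodType) (A : {set V}).
Hypothesis A_zmod : zmod_closed (mem A).

Lemma sum_translate (R : nmodType) (f : V -> R) a :
  a \in A -> \sum_(x in A) f (x + a) = \sum_(x in A) f x.
Proof.
case: A_zmod => A0 AB aA; rewrite [RHS](reindex_inj (addIr a)).
apply: eq_bigl => x /=; apply/idP/idP => xA; last by rewrite -[x](addrK a) AB.
by rewrite -[a]opprK AB // -[- a]sub0r AB.
Qed.

(** If chi a = -1 for some a in A, translation by a negates the sum. *)
Lemma sum_character (chi : V -> int) :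
    {in A &, forall x y, chi (x + y) = chi x * chi y} ->
    (forall x, chi x ^+ 2 = 1) ->
  \sum_(x in A) chi x = #|A|%:Z * [forall x in A, chi x == 1]%:Z.
Proof.
move=> chiD chi2; case: (boolP [forall x in A, _]) => [/forall_inP triv|].
  by rewrite mulr1 (eq_bigr (fun=> 1)) ?sumr_const ?natz // => x /triv/eqP.
rewrite negb_forall_in => /exists_inP[a aA chia]; rewrite mulr0.
have chiaN : chi a = -1.
  by have /eqP := chi2 a; rewrite sqrf_eq1 (negPf chia) => /eqP.
have := sum_translate chi aA.
rewrite (eq_bigr (fun x => - chi x)) => [|x xA]; last first.
  by rewrite chiD // chiaN mulrN1.
by rewrite sumrN; move: (\sum_(x in A) _) => S; lia.
Qed.

End CharacterSums.

Section QuadraticCharacter.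

Variables (V : finZmodType) (E : V -> int) (B : V -> V -> int).
Hypothesis E_sqr : forall x, E x ^+ 2 = 1.
Hypothesis ED : forall x y, E (x + y) = E x * E y * B x y.
Hypothesis BDl : forall x y z, B (x + y) z = B x z * B y z.

Lemma quadB_def x y : B x y = E (x + y) * E x * E y.
Proof.
rewrite ED -[LHS]mulr1 -[LHS]mulr1 -{1}(E_sqr x) -(E_sqr y); ring.
Qed.

Lemma quadB_sqr x y : B x y ^+ 2 = 1.
Proof. by rewrite quadB_def !exprMn !E_sqr. Qed.

Lemma quadB_sym x y : B x y = B y x.
Proof. by rewrite !quadB_def addrC; ring. Qed.

Lemma quadBDr x y z : B x (y + z) = B x y * B x z.
Proof. by rewrite quadB_sym BDl !(quadB_sym x). Qed.

Variable A : {set V}.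
Hypothesis A_zmod : zmod_closed (mem A).

Definition perp (U : {set V}) := [set x in A | [forall y in U, B y x == 1]].

Lemma perpP (U : {set V}) x :
  reflect (x \in A /\ {in U, forall y, B y x = 1}) (x \in perp U).
Proof.
rewrite inE; apply: (iffP andP) => -[xA].
  by move/forall_inP => h; split=> // y /h/eqP.
by move=> h; split=> //; apply/forall_inP => y /h/eqP.
Qed.

Lemma sum_quadB (U : {set V}) y : zmod_closed (mem U) ->
  y \in A -> \sum_(x in U) B x y = #|U|%:Z * (y \in perp U)%:Z.
Proof.
move=> U_zmod yA; rewrite inE yA (sum_character U_zmod) // => x; exact:
  quadB_sqr.
Qed.

(** In the square, E x * E (y + x) = E y * B x y because E x has square 1, and for
fixed y the character x |-> B x y sums to zero unless y is orthogonal to A. *)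
Lemma sqr_sum_quadratic :
  (\sum_(x in A) E x) ^+ 2 = #|A|%:Z * \sum_(x in perp A) E x.
Proof.
rewrite expr2 mulr_suml.
transitivity (\sum_(x in A) \sum_(y in A) E x * E (y + x)).
  by apply: eq_bigr => x xA; rewrite -mulr_sumr (sum_translate A_zmod E).
rewrite exchange_big /= mulr_sumr big_mkcond [RHS]big_mkcond /=.
apply: eq_bigr => y _; case: (boolP (y \in A)) => yA; last first.
  by rewrite inE (negPf yA).
rewrite (eq_bigr (fun x => E y * B x y)) => [|x _]; last first.
  by rewrite ED (quadB_sym y) -[RHS]mulr1 -(E_sqr x); ring.
rewrite -mulr_sumr sum_quadB //.
by case: (y \in perp A); rewrite ?mulr1 ?mulr0 // mulrC.
Qed.

Lemma perp_zmod : zmod_closed (mem (perp A)).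
Proof.
case: A_zmod => A0 AB; have B0 x : B x 0 = 1.
  have := quadBDr x 0 0; rewrite addr0 => B00; have := quadB_sqr x 0.
  by rewrite expr2 -B00.
split=> [|x y /perpP[xA xW] /perpP[yA yW]].
  by apply/perpP; split=> // x _; apply: B0.
apply/perpP; split; first exact: AB.
by move=> z zA; have := xW z zA; rewrite -{1}[x](subrK y) quadBDr (yW z zA)
  mulr1.
Qed.

(** On the radical the polarization is trivial, so E itself is a character there. *)
Lemma sum_radical :
  \sum_(x in perp A) E x = #|perp A|%:Z * [forall x in perp A, E x == 1]%:Z.
Proof.
apply: sum_character => //; first exact: perp_zmod.
move=> x y /perpP[xA _] /perpP[yA yW].
by rewrite ED yW ?mulr1.
Qed.

Variable U : {set V}.
Hypotheses (U_zmod : zmod_closed (mem U)) (UA : U \subset A).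

(** Summing B over U x A in both orders gives |U| |perp U| = |A| |U :&: perp A|. *)
Lemma card_perp_le : (#|U| * #|perp U| <= #|A| * #|perp A|)%N.
Proof.
suff eq : (#|U| * #|perp U|)%:Z = (#|A| * #|U :&: perp A|)%:Z.
  have := subset_leq_card (subsetIr U (perp A)).
  by move/(leq_mul (leqnn #|A|)); move: eq => [->].
have card (T1 T2 : {set V}) : T2 \subset T1 ->
    \sum_(x in T1) (x \in T2)%:Z = #|T2|%:Z.
  move=> T21; rewrite -[RHS]natz -sum1_card natr_sum big_mkcond [RHS]big_mkcond.
  apply: eq_bigr => x _ /=; case: ifPn => [_|xT1]; first by case: (x \in T2).
  by rewrite (negPf (contra (subsetP T21 x) xT1)).
have perpA : perp U \subset A by apply/subsetP => x /perpP[].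
rewrite !PoszM -(card A _ perpA) -(card U _ (subsetIl _ _)) !mulr_sumr.
transitivity (\sum_(x in A) \sum_(u in U) B u x).
  by apply: eq_bigr => x xA; rewrite sum_quadB.
rewrite exchange_big; apply: eq_bigr => u uU /=.
rewrite inE uU /= -sum_quadB ?(subsetP UA) //.
by apply: eq_bigr => x _; apply: quadB_sym.
Qed.

Hypothesis U_iso : {in U, forall x, E x = 1}.

Lemma isotropic_sub_perp : U \subset perp U.
Proof.
case: U_zmod => U0 UB; apply/subsetP => x xU.
apply/perpP; split=> [|y yU]; first exact: (subsetP UA).
rewrite quadB_def !U_iso // -[x]opprK UB // -[- x]sub0r UB //.
Qed.

(** Averaging over translations by U inserts the factor sum_(u in U) B u x, which
is |U| on perp U and vanishes elsewhere. *)
Lemma sum_isotropic : \sum_(x in A) E x = \sum_(x in perp U) E x.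
Proof.
have U0 : #|U|%:Z != 0.
  by rewrite eqz_nat -lt0n; apply/card_gt0P; exists 0; case: U_zmod.
apply: (mulfI U0); rewrite -[#|U|%:Z]natz -sumr_const mulr_suml.
transitivity (\sum_(u in U) \sum_(x in A) E (x + u)).
  apply: eq_bigr => u uU; rewrite mul1r (sum_translate A_zmod) //.
  exact: (subsetP UA).
rewrite exchange_big mulr_sumr big_mkcond [RHS]big_mkcond /=.
apply: eq_bigr => x _; case: (boolP (x \in A)) => xA; last first.
  by rewrite inE (negPf xA).
rewrite (eq_bigr (fun u => E x * B u x)) => [|u uU]; last first.
  by rewrite ED (quadB_sym x u) (U_iso uU) mulr1.
rewrite -mulr_sumr sum_quadB //.
by case: (x \in perp U); rewrite ?mulr1 ?mulr0 // mulrC sumr_const natz.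
Qed.

(** Inside perp U, the function E is constant on cosets of U.  The elements of T lie
in distinct cosets, and the cardinality bound says that there are no others. *)
Lemma sum_isotropic_cosets (T : {set V}) : T \subset perp U ->
    {in T &, forall v w, v - w \in U -> v = w} ->
    (#|perp U| <= #|T| * #|U|)%N ->
  \sum_(x in A) E x = #|U|%:Z * \sum_(v in T) E v.
Proof.
move=> TU T_inj card_le; pose h (p : V * V) := p.1 + p.2.
have [U0 UB] := U_zmod; have [A0 AB] := A_zmod.
have UN x : x \in U -> - x \in U by move=> xU; rewrite -sub0r UB.
have h_inj : {in setX T U &, injective h}.
  move=> [v x] [w y] /setXP[/= vT xU] /setXP[/= wT yU] eq.
  have vw : v = w.
    apply: T_inj => //; rewrite (_ : v - w = y - x) ?UB //.
    by apply/eqP; rewrite subr_eq addrAC eq_sym subr_eq (addrC y) eq_sym;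
      apply/eqP.
  by move: eq; rewrite /h /= vw => /addrI ->.
have perpE : h @: setX T U = perp U.
  apply/eqP; rewrite eqEcard card_in_imset // cardsX card_le andbT.
  apply/subsetP => _ /imsetP[[v x] /setXP[/= vT xU] ->].
  have /perpP[vA vW] := subsetP TU v vT; apply/perpP; split.
    by rewrite /h -[x]opprK AB // (subsetP UA) ?UN.
  move=> y yU; rewrite quadBDr vW // mul1r.
  by have /perpP[_ ->] := subsetP isotropic_sub_perp x xU.
rewrite sum_isotropic -perpE big_imset //=.
rewrite (eq_bigl (fun p => (p.1 \in T) && (p.2 \in U))) => [|p]; last by
  rewrite !inE.
rewrite -(pair_big (mem T) (mem U) (fun v x => E (h (v, x)))) /= mulr_sumr.
apply: eq_bigr => v vT; transitivity (\sum_(x in U) E v); last first.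
  by rewrite sumr_const -[E v *+ _]mulr_natl natz.
apply: eq_bigr => x xU; rewrite /h /= ED (U_iso xU) mulr1 quadB_sym.
by have /perpP[_ ->] := subsetP TU v vT; rewrite ?mulr1.
Qed.

End QuadraticCharacter.

(** * Frobenius powers and the additive character in characteristic two *)

Lemma card_additive_image (V W : finZmodType) (A : {set V}) (f : V -> W) :
    zmod_closed (mem A) -> {in A &, forall x y, f (x - y) = f x - f y} ->
  #|A| = (#|f @: A| * #|[set x in A | f x == 0%R]|)%N.
Proof.
move=> A_zmod fB; have [A0 AB] := A_zmod.
rewrite -sum1_card (partition_big_imset f) /= -sum_nat_const.
apply: eq_bigr => _ /imsetP[a aA ->]; rewrite sum1dep_card.
rewrite -(card_imset _ (addIr (- a))); apply: eq_card => x.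
rewrite inE; apply/imsetP/andP => [[y /[!inE] /andP[yA /eqP fy] ->]|[xA /eqP
  fx]].
  by rewrite AB // fB // fy subrr.
have xaA : x + a \in A by rewrite -[a]opprK AB // -[- a]sub0r AB.
exists (x + a); last by rewrite addrK.
by rewrite inE xaA -subr_eq0 -fB // addrK fx /=.
Qed.

(** Locked: otherwise unification identifies Frobenius powers with explicit powers
and products. *)
HB.lock Definition frob (K : finFieldType) (i : nat) (x : K) : K :=
  x ^+ (2 ^ i).

Section Char2.
Variables (K : finFieldType) (N : nat).
Implicit Types (x y z : K).
Hypothesis cardK : #|K| = (2 ^ N)%N.

Lemma pchar2 : 2 \in [pchar K].
Proof. exact: (card_finPcharP cardK). Qed.

Lemma two0 : 2%:R = 0 :> K.
Proof. exact: pcharf0 pchar2. Qed.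

Lemma natr_odd k : k%:R = (odd k)%:R :> K.
Proof.
by rewrite -[in LHS](odd_double_half k) natrD -mul2n natrM two0 mul0r addr0.
Qed.

End Char2.

(* The ring tactic rewrites a numeral only where it is a whole coefficient, so
   reduction modulo 2 takes one equation per coefficient that may occur. *)
Ltac with_char2 cardK tac :=
  tac
      constr:(natr_odd cardK 2 : 2 = 0) constr:(natr_odd cardK 3 : 3 = 1)
      constr:(natr_odd cardK 4 : 4 = 0) constr:(natr_odd cardK 5 : 5 = 1)
      constr:(natr_odd cardK 6 : 6 = 0) constr:(natr_odd cardK 7 : 7 = 1)
      constr:(natr_odd cardK 8 : 8 = 0) constr:(natr_odd cardK 9 : 9 = 1)
      constr:(natr_odd cardK 10 : 10 = 0) constr:(natr_odd cardK 11 : 11 = 1)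
      constr:(natr_odd cardK 12 : 12 = 0) constr:(natr_odd cardK 13 : 13 = 1)
      constr:(natr_odd cardK 14 : 14 = 0) constr:(natr_odd cardK 15 : 15 = 1)
      constr:(natr_odd cardK 16 : 16 = 0) constr:(natr_odd cardK 17 : 17 = 1).

Ltac ring2 cardK :=
  with_char2 cardK ltac:(fun c2 c3 c4 c5 c6 c7 c8 c9 c10 c11 c12 c13 c14 c15
    c16 c17 =>
    ring: c2 c3 c4 c5 c6 c7 c8 c9 c10 c11 c12 c13 c14 c15 c16 c17).
Ltac ring2_with cardK H :=
  with_char2 cardK ltac:(fun c2 c3 c4 c5 c6 c7 c8 c9 c10 c11 c12 c13 c14 c15
    c16 c17 =>
    ring: H c2 c3 c4 c5 c6 c7 c8 c9 c10 c11 c12 c13 c14 c15 c16 c17).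

Section Frobenius.
Variables (K : finFieldType) (N : nat).
Implicit Types (x y z : K).
Hypothesis cardK : #|K| = (2 ^ N)%N.
Local Notation two0 := (two0 cardK).

Lemma addxx (x : K) : x + x = 0.
Proof. by rewrite -mulr2n -mulr_natr two0 mulr0. Qed.

Lemma opp2 (x : K) : - x = x.
Proof. by apply/eqP; rewrite eq_sym -addr_eq0 addxx. Qed.

Lemma add2K (x y : K) : x + y + y = x.
Proof. by rewrite -addrA addxx addr0. Qed.

Lemma add2_eq0 (x y : K) : x + y = 0 -> x = y.
Proof. by move/eqP; rewrite addr_eq0 opp2 => /eqP. Qed.

Lemma zmod_closed2 (A : {set K}) :
  0 \in A -> {in A &, forall x y, x + y \in A} -> zmod_closed (mem A).
Proof. by move=> A0 AD; split=> // x y xA yA; rewrite opp2 AD. Qed.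

Lemma frobE i x : frob i x = x ^+ (2 ^ i). Proof. by rewrite unlock. Qed.

Lemma frob_comp i j x : frob i (frob j x) = frob (i + j) x.
Proof. by rewrite !frobE -exprM -expnD addnC. Qed.

Lemma frobC i j x : frob i (frob j x) = frob j (frob i x).
Proof. by rewrite !frob_comp addnC. Qed.

Lemma frob0 x : frob 0 x = x. Proof. by rewrite frobE expr1. Qed.
Lemma frob1 x : frob 1 x = x ^+ 2. Proof. by rewrite frobE. Qed.
Lemma frobM i x y : frob i (x * y) = frob i x * frob i y.
Proof. by rewrite !frobE exprMn. Qed.
Lemma frobX i x n : frob i (x ^+ n) = frob i x ^+ n.
Proof. by rewrite !frobE exprAC. Qed.
Lemma frobV i x : frob i x^-1 = (frob i x)^-1.
Proof. by rewrite !frobE exprVn. Qed.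
Lemma frob_1 i : frob i 1 = 1 :> K. Proof. by rewrite !frobE expr1n. Qed.
Lemma frob_0 i : frob i 0 = 0 :> K.
Proof. by rewrite frobE expr0n expn_eq0. Qed.

Lemma sqrD2 (x y : K) : (x + y) ^+ 2 = x ^+ 2 + y ^+ 2.
Proof. by ring2 cardK. Qed.

Lemma frobD i x y : frob i (x + y) = frob i x + frob i y.
Proof.
elim: i => [|i IH]; first by rewrite !frob0.
by rewrite -add1n -!frob_comp IH !frob1 sqrD2.
Qed.

Lemma frobN x : frob N x = x.
Proof. by rewrite frobE -cardK expf_card. Qed.

Lemma frob_mul i k x : frob i x = x -> frob (i * k) x = x.
Proof.
move=> fx; elim: k => [|k IH]; first by rewrite muln0 frob0.
by rewrite mulnS -frob_comp IH.
Qed.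

Lemma frob_dvd i j x : (i %| j)%N -> frob i x = x -> frob j x = x.
Proof. by move=> /dvdnP[k ->] fx; rewrite mulnC frob_mul. Qed.

Lemma frob_inj i : injective (@frob K i).
Proof.
have fr1_inj : injective (@frob K 1).
  move=> x y; rewrite !frob1 => eq; have /eqP := sqrD2 x y.
  by rewrite eq addxx expf_eq0 => /eqP/add2_eq0.
elim: i => [|i IH] x y; first by rewrite !frob0.
by rewrite -add1n -!frob_comp => /fr1_inj/IH.
Qed.

(** Bezout: a multiple of i is a multiple of N plus the gcd, and frob N is trivial. *)
Lemma frob_gcd i x : frob i x = x -> frob (gcdn i N) x = x.
Proof.
move=> fx; case: (posnP i) => [->|i_gt0]; first by rewrite gcd0n frobN.
have [a b eq _] := egcdnP N i_gt0.
apply: (@frob_inj (b * N)); rewrite frob_comp -eq !(mulnC _ i, mulnC _ N).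
by rewrite (frob_mul _ fx) (frob_mul _ (frobN x)).
Qed.

Definition Fix (e : nat) : {set K} := [set x | frob e x == x].

Lemma FixP e x : reflect (frob e x = x) (x \in Fix e).
Proof. by rewrite inE; apply: eqP. Qed.

Lemma FixD e : {in Fix e &, forall x y, x + y \in Fix e}.
Proof. by move=> x y /FixP fx /FixP fy; apply/FixP; rewrite frobD fx fy. Qed.

Lemma FixM e : {in Fix e &, forall x y, x * y \in Fix e}.
Proof. by move=> x y /FixP fx /FixP fy; apply/FixP; rewrite frobM fx fy. Qed.

Lemma Fix_frob e i x : x \in Fix e -> frob i x \in Fix e.
Proof. by move=> /FixP fx; apply/FixP; rewrite frobC fx. Qed.

Lemma Fix0 e : 0 \in Fix e. Proof. by apply/FixP/frob_0. Qed.
Lemma Fix1 e : 1 \in Fix e. Proof. by apply/FixP/frob_1. Qed.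

Lemma Fix_dvd i j x : (i %| j)%N -> x \in Fix i -> x \in Fix j.
Proof. by move=> ij /FixP fx; apply/FixP/(frob_dvd ij). Qed.

Lemma Fix_zmod e : zmod_closed (mem (Fix e)).
Proof. by apply: zmod_closed2; [apply: Fix0 | apply: FixD]. Qed.

Lemma FixN : Fix N = setT.
Proof. by apply/setP => x; rewrite !inE frobN eqxx. Qed.

Lemma Fix_gcd i : Fix i = Fix (gcdn i N).
Proof.
apply/setP => x; apply/FixP/FixP; first exact: frob_gcd.
by apply: frob_dvd; apply: dvdn_gcdl.
Qed.

(** The polynomial X^(2^e) - X divides X^(2^N) - X, the product of all X - x, so it
has as many roots as its degree. *)
Lemma card_Fix e : (0 < e)%N -> (e %| N)%N -> #|Fix e| = (2 ^ e)%N.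
Proof.
move=> e_gt0 /dvdnP[k Nk].
pose P i : {poly K} := 'X^(2 ^ i) - 'X.
have P_fact i : P i = 'X * ('X^((2 ^ i).-1) - 1).
  by rewrite mulrBr mulr1 -exprS prednK ?expn_gt0.
have sizeP : size (P e) = (2 ^ e).+1.
  rewrite size_polyDl ?size_polyN ?size_polyXn // size_polyX ltnS.
  exact: (@leq_pexp2l 2 1 e).
have dvdP : P e %| P N.
  rewrite !P_fact dvdp_mul2l ?polyX_eq0 //.
  have /dvdnP[j ->] : ((2 ^ e).-1 %| (2 ^ N).-1)%N.
    by rewrite Nk mulnC expnM dvdn_pred_predX.
  rewrite [(j * _)%N]mulnC exprM (subrX1 'X^_ j).
  exact: dvdp_mulr.
rewrite /P -cardK finField_genPoly in dvdP.
have [m eqp] := dvdp_prod_XsubC dvdP.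
set rs := mask m _ in eqp.
have uniq_rs : uniq rs by rewrite mask_uniq // index_enum_uniq.
have mem_rs : rs =i Fix e.
  move=> x; have := eqp_root eqp x; rewrite root_prod_XsubC => <-.
  by rewrite inE rootE !hornerE subr_eq0 frobE.
rewrite -(eq_card mem_rs) (card_uniqP uniq_rs).
by apply: succn_inj; rewrite -sizeP (eqp_size eqp) size_prod_XsubC.
Qed.

(** Additive Hilbert 90 for a quadratic extension, by counting: the map x + frob e x
from Fix (2 * e) to Fix e has kernel Fix e. *)
Lemma trace_onto e y : (0 < e)%N -> (2 * e %| N)%N -> y \in Fix e ->
  exists2 x, x \in Fix (2 * e) & x + frob e x = y.
Proof.
move=> e_gt0 eN yF; have eN' := dvdn_trans (dvdn_mull 2 (dvdnn e)) eN.
pose f x := x + frob e x.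
have fB : {in Fix (2 * e) &, forall x z, f (x - z) = f x - f z}.
  by move=> x z _ _; rewrite /f !opp2 frobD addrACA.
have kerf : [set x in Fix (2 * e) | f x == 0] = Fix e.
  apply/setP => x; rewrite inE; apply/andP/FixP => [[_ /eqP/add2_eq0]|fx] //.
  split; last by rewrite /f fx addxx.
  by apply: Fix_dvd (introT (FixP _ _) fx); apply: dvdn_mull.
have := card_additive_image (Fix_zmod _) fB.
rewrite kerf !card_Fix ?muln_gt0 //.
rewrite [in (2 ^ (2 * e))%N]mul2n -addnn expnD => /eqP.
rewrite eqn_pmul2r ?expn_gt0 // => /eqP imf.
have sub : f @: Fix (2 * e) \subset Fix e.
  apply/subsetP => _ /imsetP[x /FixP fx ->]; apply/FixP.
  by rewrite /f frobD frob_comp addnn -mul2n fx addrC.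
have /eqP imE : f @: Fix (2 * e) == Fix e.
  by rewrite eqEcard sub card_Fix //= ?imf.
by move: yF; rewrite -imE => /imsetP[x xF ->]; exists x.
Qed.

(** Equal to (-1)^(Tr x) for the absolute trace Tr.  With the Artin-Schreier equation
as definition, the link with points of the curve and the behaviour on subfields
of odd index need no traces. *)
Definition psi (x : K) : int := if [exists z, z ^+ 2 + z == x] then 1 else -1.

Lemma psi_AS z : psi (z ^+ 2 + z) = 1.
Proof. by rewrite /psi ifT //; apply/existsP; exists z. Qed.

Lemma psiP x : psi x = 1 -> exists z, z ^+ 2 + z = x.
Proof. by rewrite /psi; case: existsP => // -[z /eqP <-] _; exists z. Qed.

Lemma psi_sqr x : psi x ^+ 2 = 1.
Proof. by rewrite /psi; case: ifP. Qed.

Lemma AS_fiber (a z : K) : z ^+ 2 + z = a ->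
  [set y : K | y ^+ 2 + y == a] = [set z; z + 1].
Proof.
move=> za; apply/setP => y; rewrite !inE -za -subr_eq0.
rewrite -(subr_eq0 y z) -(subr_eq0 y (z + 1)) -mulf_eq0.
by rewrite !opp2; congr (_ == 0); ring2 cardK.
Qed.

Lemma card_AS_fiber (a : K) :
  #|[set y : K | y ^+ 2 + y == a]|%:Z = 1 + psi a.
Proof.
rewrite /psi; case: existsP => [[z /eqP /AS_fiber ->]|no].
  by rewrite cards2 -subr_eq0 opprD addNKr oppr_eq0 oner_eq0.
rewrite (_ : [set y | _] = set0) ?cards0 //; apply/setP => y; rewrite !inE.
by apply/negP => ya; apply: no; exists y.
Qed.

Let H := [set z ^+ 2 + z | z in [set: K]].

Lemma psiE x : psi x = if x \in H then 1 else -1.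
Proof.
rewrite /psi; congr (if _ then _ else _).
apply/existsP/imsetP => -[z]; first by move/eqP <-; exists z.
by move=> _ ->; exists z.
Qed.

(** The values z^2 + z form a subgroup of index two, so the sum of two elements
outside it lies inside. *)
Lemma psiD x y : psi (x + y) = psi x * psi y.
Proof.
have fB : {in [set: K] &, forall x y : K, (x - y) ^+ 2 + (x - y) =
           (x ^+ 2 + x) - (y ^+ 2 + y)}.
  by move=> u v _ _; rewrite !opp2 sqrD2 addrACA.
have Tz : zmod_closed (mem [set: K]) by split=> [|x0 y0 _ _]; apply/(in_setT _).
have := card_additive_image Tz fB; rewrite -/H.
rewrite (_ : [set x in _ | _] = [set 0; 1]); last first.
  apply/setP => z; rewrite !inE /= -[z in X in _ + X]mulr1 -mulrDr mulf_eq0.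
  by rewrite addr_eq0 opp2.
rewrite cardsT cards2 eq_sym oner_eq0 => cardH.
have HD : {in H &, forall u v, u + v \in H}.
  move=> _ _ /imsetP[u _ ->] /imsetP[v _ ->]; apply/imsetP; exists (u + v) =>
    //.
  by rewrite sqrD2 addrACA.
rewrite !psiE; case: (boolP (x \in H)) => xH; case: (boolP (y \in H)) => yH.
- by rewrite HD.
- by rewrite ifF //; apply: contraNF yH => h; rewrite -(add2K y x) addrC (addrC
  y) HD // addrC.
- by rewrite ifF //; apply: contraNF xH => h; rewrite -(add2K x y) HD.
have xHH : [disjoint H & [set x + h | h in H]].
  apply/pred0Pn => -[u /andP[/= uH /imsetP[h hH eq]]].
  by move: xH; rewrite -(add2K x h) -eq HD.
have HxH : H :|: [set x + h | h in H] = setT.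
  apply/eqP; rewrite eqEcard subsetT cardsT cardsU disjoint_setI0 // cards0.
  by rewrite subn0 (card_imset _ (addrI x)) addnn -muln2 cardH /= leqnn.
have : y \in H :|: [set x + h | h in H] by rewrite HxH in_setT.
rewrite inE (negPf yH) => /imsetP[h hH ->].
by rewrite addrA addxx add0r hH.
Qed.

End Frobenius.

Arguments Fix {K} e.

(** * The cubic form, its polarization and its radical *)

Section CubicForm.
Variables (K : finFieldType) (N : nat).
Implicit Types (a x y z : K).
Hypothesis cardK : #|K| = (2 ^ N)%N.

(** The right-hand side of the curve for sigma = frob s; cubic in x over K, but
quadratic over F_2, as each monomial is a product of two Frobenius powers. *)
Definition cubic (s : nat) (a x : K) : K :=
  a * (x * frob s x ^+ 2 + x ^+ 2 * frob s x).

Definition polar (s : nat) (a x y : K) : K :=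
  a * (x * frob s y ^+ 2 + y * frob s x ^+ 2
       + x ^+ 2 * frob s y + y ^+ 2 * frob s x).

Lemma cubicD s a x y :
  cubic s a (x + y) = cubic s a x + cubic s a y + polar s a x y.
Proof. by rewrite /cubic /polar (frobD cardK); ring2 cardK. Qed.

Lemma polarDl s a x y z : polar s a (x + y) z = polar s a x z + polar s a y z.
Proof. by rewrite /polar (frobD cardK); ring2 cardK. Qed.

Lemma polarC s a x y : polar s a x y = polar s a y x.
Proof. by rewrite /polar; ring. Qed.

Section TraceLike.

Variables (e : nat) (chi : K -> int).
Hypothesis chiD : {in Fix e &, forall x y, chi (x + y) = chi x * chi y}.
Hypothesis chi_sq : {in Fix e, forall x, chi (x ^+ 2) = chi x}.

Lemma chi_frob_in i x : x \in Fix e -> chi (frob i x) = chi x.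
Proof.
elim: i x => [|i IH] x xF; first by rewrite frob0.
by rewrite -addn1 -frob_comp IH ?frob1 ?chi_sq // -frob1 Fix_frob.
Qed.

Lemma FixX i n x : x \in @Fix K i -> x ^+ n \in Fix i.
Proof. by move=> /FixP fx; apply/FixP; rewrite frobX fx. Qed.

(** Each term of the polarization is moved by a power of Frobenius, which chi does
not notice, until x occurs only as frob s x ^+ 2; the coefficients then combine
into a polynomial in w.  The character chi is arbitrary because the lemma serves
both for psi on K and for a twist of it on a subfield. *)
Lemma chi_polar s a x y :
    a \in Fix e -> x \in Fix e -> y \in Fix e -> frob s a = a ->
    let w := frob (s + s) y + y in
  chi (polar s a x y) = chi (frob s x ^+ 2 * (a * (a * w ^+ 4 + w))).
Proof.
move=> aF xF yF fa w.
have -> : polar s a x y = a * (x * frob s y ^+ 2) + a * (y * frob s x ^+ 2)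
  + a * (x ^+ 2 * frob s y) + a * (y ^+ 2 * frob s x) by rewrite /polar !mulrDr.
have FM := @FixM K e; have FX := @FixX e; have Ff := @Fix_frob K e.
have t1F : a * (x * frob s y ^+ 2) \in Fix e by rewrite !(FM, FX, Ff).
have t2F : a * (y * frob s x ^+ 2) \in Fix e by rewrite !(FM, FX, Ff).
have t3F : a * (x ^+ 2 * frob s y) \in Fix e by rewrite !(FM, FX, Ff).
have t4F : a * (y ^+ 2 * frob s x) \in Fix e by rewrite !(FM, FX, Ff).
have FD := FixD cardK.
rewrite ![in LHS]chiD ?FD // -(chi_frob_in (s + 1) t1F) -(chi_frob_in s t3F)
  -(chi_frob_in 1 t4F).
rewrite -!chiD ?FD ?Ff //; congr chi.
rewrite -!(frob_comp s 1) !frob1 !(frobX, frobM) !fa /w -!(frob_comp s s).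
ring2 cardK.
Qed.

End TraceLike.

Lemma psi0 : psi (0 : K) = 1.
Proof. by rewrite -(psi_AS (0 : K)) expr0n addr0. Qed.

Lemma psi_sq x : psi (x ^+ 2) = psi x.
Proof.
have := psi_AS x; rewrite (psiD cardK) => eq.
by rewrite -[LHS]mulr1 -(psi_sqr x) expr2 mulrA eq mul1r.
Qed.

Lemma psi_frob i x : psi (frob i x) = psi x.
Proof.
elim: i => [|i IH]; first by rewrite frob0.
by rewrite -add1n -frob_comp frob1 psi_sq.
Qed.

Lemma psi_polar s a x y : frob s a = a ->
    let w := frob (s + s) y + y in
  psi (polar s a x y) = psi (frob s x ^+ 2 * (a * (a * w ^+ 4 + w))).
Proof.
move=> fa; apply: (@chi_polar N); rewrite ?(FixN cardK) ?inE //.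
- by move=> u v _ _; apply: (psiD cardK).
- by move=> u _; apply: psi_sq.
Qed.

Section Nontrivial.
Variable e : nat.
Hypotheses (e_gt0 : (0 < e)%N) (e_dvd : (e %| N)%N) (odd_deg : odd (N %/ e)).

(** Otherwise frob e z is the other root z + 1, and an odd number of applications of
frob e would not lead back to z. *)
Lemma AS_odd_degree z : z ^+ 2 + z \in @Fix K e -> z \in Fix e.
Proof.
move=> /FixP; rewrite (frobD cardK) frobX => eq.
have : frob e z \in [set y | y ^+ 2 + y == z ^+ 2 + z] by rewrite inE eq.
rewrite (AS_fiber cardK (erefl (z ^+ 2 + z))) !inE => /orP[/eqP fz|/eqP fz].
  by rewrite fz.
have step k : frob (e * k) z = z + (odd k)%:R.
  elim: k => [|k IH]; first by rewrite muln0 frob0 addr0.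
  rewrite mulnS -frob_comp IH (frobD cardK) fz -addrA /=; congr (_ + _).
  by case: (odd k); rewrite /= ?frob_1 ?frob_0 ?addr0 ?(addxx cardK).
have := step (N %/ e)%N; rewrite mulnC divnK // (frobN cardK) odd_deg.
by rewrite -{1}[z]addr0 => /addrI/eqP; rewrite eq_sym oner_eq0.
Qed.

(** Were psi trivial on Fix e, z^2 + z would map the finite set Fix e onto itself,
although it sends both 0 and 1 to 0. *)
Lemma psi_nontrivial : exists2 z, z \in @Fix K e & psi z = -1.
Proof.
case: (boolP [exists z in @Fix K e, psi z != 1]) => [/exists_inP[z zF]|].
  have := psi_sqr z => /eqP; rewrite sqrf_eq1 => /orP[/eqP ->|/eqP pz] // _.
  by exists z.
rewrite negb_exists_in => /forall_inP all1.
have fB : {in @Fix K e &, forall x y,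
    (x - y) ^+ 2 + (x - y) = (x ^+ 2 + x) - (y ^+ 2 + y)}.
  by move=> u v _ _; rewrite !(opp2 cardK) (sqrD2 cardK) addrACA.
have := card_additive_image (Fix_zmod cardK _) fB.
set I := imset _ _; set k := [set x in _ | _].
have -> : I = Fix e.
  apply/setP => z; apply/imsetP/idP => [[y yF ->]|zF].
    by rewrite (FixD cardK) // FixX.
  have := all1 z zF; rewrite negbK => /eqP/psiP[y yz]; exists y => //.
  by apply: AS_odd_degree; rewrite yz.
have : (1 < #|k|)%N.
  apply: (leq_trans _ (subset_leq_card (_ : [set 0; 1] \subset k))).
    by rewrite cards2 eq_sym oner_eq0.
  apply/subsetP => z; rewrite !inE => /orP[]/eqP ->.
    by rewrite frob_0 expr0n addr0 !eqxx.
  by rewrite frob_1 expr1n (addxx cardK) !eqxx.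
rewrite (card_Fix cardK) //; move: #|k| => j j1 eq.
have : (2 ^ e * 1 < 2 ^ e * j)%N by rewrite ltn_pmul2l ?expn_gt0.
by rewrite -eq muln1 ltnn.
Qed.

Definition cubic_char (s : nat) (a x : K) : int := psi (cubic s a x).
Definition polar_char (s : nat) (a x y : K) : int := psi (polar s a x y).

Lemma cubic_char_sqr s a x : cubic_char s a x ^+ 2 = 1.
Proof. exact: psi_sqr. Qed.
Lemma cubic_charD s a x y : cubic_char s a (x + y)
  = cubic_char s a x * cubic_char s a y * polar_char s a x y.
Proof. by rewrite /cubic_char cubicD !(psiD cardK). Qed.
Lemma polar_charDl s a x y z :
  polar_char s a (x + y) z = polar_char s a x z * polar_char s a y z.
Proof. by rewrite /polar_char polarDl (psiD cardK). Qed.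

Lemma cubic_char0 s a : cubic_char s a 0 = 1.
Proof.
by rewrite /cubic_char /cubic frob_0 expr0n !(mul0r, mulr0) addr0 mulr0 psi0.
Qed.
Lemma polar_char0 s a y : polar_char s a 0 y = 1.
Proof.
by rewrite /polar_char /polar frob_0 !(mul0r, mulr0, expr0n, addr0) psi0.
Qed.

(** As frob s x ^+ 2 runs through the whole of Fix e, the other factor in chi_polar
must vanish. *)
Lemma radicalP s a y : frob s a = a -> a != 0 -> a \in Fix e ->
    let w := frob (s + s) y + y in
  reflect (y \in Fix e /\ a * w ^+ 4 = w)
    (y \in perp (polar_char s a) (Fix e) (Fix e)).
Proof.
move=> fa a0 aF w; apply: (iffP (perpP _ _ _ _)) => -[yF yW]; split=> //; last
  first.
  by move=> x _; rewrite /polar_char psi_polar // yW (addxx cardK) !mulr0 psi0.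
have [z zF pz] := psi_nontrivial.
apply: (add2_eq0 cardK); apply/eqP/negPn/negP => b0.
set b := a * w ^+ 4 + w in b0.
have abF : a * b \in Fix e.
  by rewrite /b /w !(FixM, FixD cardK, FixX, Fix_frob).
have xK : frob (N * (s + 1) - (s + 1)) (z / (a * b)) \in Fix e.
  by rewrite Fix_frob // FixM //; apply/FixP; rewrite frobV; congr _^-1;
    apply/FixP.
have := yW _ xK; rewrite /polar_char psi_polar // -/w -/b.
have N_gt0 : (0 < N)%N by move: odd_deg; case: (N) => //; rewrite div0n.
have -> : frob s (frob (N * (s + 1) - (s + 1)) (z / (a * b))) ^+ 2 = z / (a *
  b).
  rewrite -frob1 !frob_comp (addnC 1) subnKC ?leq_pmull //.
  by rewrite (frob_mul _ (frobN cardK _)).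
by rewrite mulrVK ?pz // unitfE mulf_neq0.
Qed.

End Nontrivial.

End CubicForm.

(** * Counting modulo the length of the orbits *)

Section OrbitCount.
Variables (T : finType) (g : T -> T) (p : nat).
Hypothesis p_pr : prime p.

(** The orbits of g on P have length 1 or p.  As g need not be a permutation outside
P, it is replaced there by the identity. *)
Lemma card_fixed_mod (P : {set T}) :
    {in P, forall x, g x \in P} -> {in P, forall x, iter p g x = x} ->
  #|P| = #|[set x in P | g x == x]| %[mod p].
Proof.
move=> gP gp; pose h x := if x \in P then g x else x.
have hP x : (h x \in P) = (x \in P) by rewrite /h; case: ifP => // /gP.
have itP k x : x \in P -> iter k g x \in P.
  by move=> xP; elim: k => //= k; apply: gP.
have iter_h k x : iter k h x = if x \in P then iter k g x else x.
  elim: k => [|k IH] /=; first by case: ifP.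
  by rewrite IH /h; case: (boolP (x \in P)) => xP; rewrite ?itP ?(negPf xP).
have hp x : iter p h x = x by rewrite iter_h; case: ifP => // /gp.
have h_inj : injective h.
  apply: (@can_inj _ _ _ (iter p.-1 h)) => x.
  by rewrite -iterSr prednK ?prime_gt0.
pose s := perm h_inj.
have sX : (s ^+ p)%g = 1%g.
  by apply/permP => x; rewrite permX perm1 (eq_iter (permE h_inj)) hp.
have pgs : (p.-group <[s]>)%g.
  by rewrite /pgroup (pnat_dvd _ (pnat_id p_pr)) // -/(order s) order_dvdn sX.
have actP : [acts <[s]>%g, on P | 'P].
  rewrite cycle_subG !inE /=; apply/subsetP => x xP.
  by rewrite inE /= /aperm permE hP.
rewrite (pgroup_fix_mod pgs actP); congr (_ %% _)%N.
apply: eq_card => x; rewrite afix_cycle !inE sub1set inE /= /aperm permE /h.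
by case: (x \in P).
Qed.

Lemma sum_sign (P : {set T}) (f : T -> int) : (forall x, f x ^+ 2 = 1) ->
  \sum_(x in P) f x = 2 * #|[set x in P | f x == 1]|%:Z - #|P|%:Z.
Proof.
have cardE (Q : {set T}) : #|Q|%:Z = \sum_(x in Q) 1 by rewrite sumr_const natz.
move=> f2; rewrite !cardE mulr_sumr.
rewrite [X in X - _](eq_bigl (fun x => (x \in P) && (f x == 1))); last first.
  by move=> x; rewrite inE.
rewrite big_mkcondr -sumrB; apply: eq_bigr => x _.
have /eqP := f2 x; rewrite sqrf_eq1 => /orP[]/eqP ->; first by rewrite eqxx.
by rewrite eq_sym -subr_eq0 opprK.
Qed.

(** A sum of signs is a combination of the cardinals of the domain and of the level
set of 1, both of which are stable under g. *)
Lemma sum_fixed_mod (P : {set T}) (f : T -> int) :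
    {in P, forall x, g x \in P} -> {in P, forall x, iter p g x = x} ->
    (forall x, f x ^+ 2 = 1) -> {in P, forall x, f (g x) = f x} ->
  (p %| \sum_(x in P) f x - \sum_(x in P | g x == x) f x)%Z.
Proof.
move=> gP gp f2 fg.
have -> : \sum_(x in P | g x == x) f x = \sum_(x in [set x in P | g x == x]) f
  x.
  by apply: eq_bigl => x; rewrite inE.
rewrite !sum_sign //; set P1 := [set x in P | f x == 1].
have -> : [set x in [set x in P | g x == x] | f x == 1]
    = [set x in P1 | g x == x].
  by apply/setP => x; rewrite !inE -!andbA; congr (_ && _); rewrite andbC.
have gP1 : {in P1, forall x, g x \in P1}.
  by move=> x; rewrite !inE => /andP[xP fx]; rewrite gP //= fg.
have gp1 : {in P1, forall x, iter p g x = x}.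
  by move=> x; rewrite inE => /andP[xP _]; apply: gp.
have /eqP := card_fixed_mod gP gp; have /eqP := card_fixed_mod gP1 gp1.
rewrite -!eqz_nat -!modz_nat !eqz_mod_dvd => d1 d2.
rewrite [X in (_ %| X)%Z](_ : _ = 2 * (#|P1|%:Z - #|[set x in P1 | g x ==
  x]|%:Z)
   - (#|P|%:Z - #|[set x in P | g x == x]|%:Z)); last by ring.
by rewrite rpredB // dvdz_mull.
Qed.

End OrbitCount.

(** * The size of the radical *)

Lemma finField_prim_root (F : finFieldType) :
  exists z : F, (#|F|.-1).-primitive_root z.
Proof.
have F_gt1 : (1 < #|F|)%N.
  by rewrite -cardsT (cardsD1 0) inE (cardsD1 1) !inE oner_eq0.
pose rs := [seq x <- enum F | x != 0].
have sz : size rs = #|F|.-1.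
  have := count_predC (pred1 0) (enum F); rewrite -cardE size_filter => <-.
  by rewrite count_uniq_mem ?enum_uniq // mem_enum.
have : has (#|F|.-1).-primitive_root rs.
  apply: has_prim_root; rewrite ?sz //.
  - by rewrite -subn1 subn_gt0.
  - apply/allP => x; rewrite mem_filter => /andP[x0 _].
    apply/unity_rootP/(mulfI x0); rewrite mulr1 -exprS prednK ?expf_card //.
    exact: ltnW.
  - by rewrite filter_uniq ?enum_uniq.
by move=> /hasP[z _ zP]; exists z.
Qed.

Lemma cube_criterion (F : finFieldType) (m : nat) (a : F) :
  #|F|.-1 = (3 * m)%N -> a != 0 -> a ^+ m = 1 -> exists c, a = c ^+ 3.
Proof.
move=> cardF a0 am; have [z zP] := finField_prim_root F; rewrite cardF in zP.
have m_gt0 : (0 < m)%N by have := prim_order_gt0 zP; rewrite muln_gt0.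
have /(prim_rootP zP)[i az] : a ^+ (3 * m) = 1 by rewrite mulnC exprM am expr1n.
move: am; rewrite az -exprM => /eqP; rewrite -(prim_order_dvd zP).
by rewrite dvdn_pmul2r // => /dvdnP[j ->]; exists (z ^+ j); rewrite exprM.
Qed.

Section Radical.
Variables (K : finFieldType) (N : nat).
Implicit Types (a x y z w : K).
Hypothesis cardK : #|K| = (2 ^ N)%N.
Hypothesis N_gt0 : (0 < N)%N.

(** Summing over the subfield Fix e keeps the sums for all intermediate fields inside
a single K. *)
Definition cubic_sum (e s : nat) a : int :=
  \sum_(x in @Fix K e) cubic_char s a x.

Definition radical (e s : nat) a := perp (polar_char s a) (@Fix K e) (Fix e).

Lemma cubic_sum_sqr e s a : cubic_sum e s a ^+ 2 =
  #|@Fix K e|%:Z *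
    (#|radical e s a|%:Z
     * [forall x in radical e s a, cubic_char s a x == 1]%:Z).
Proof.
have Ez := Fix_zmod cardK e.
rewrite /cubic_sum (sqr_sum_quadratic (@cubic_char_sqr K s a) (cubic_charD
  cardK s a) (polar_charDl cardK s a) Ez).
by rewrite (sum_radical (@cubic_char_sqr K s a) (cubic_charD cardK s a)
  (polar_charDl cardK s a) Ez).
Qed.

(** The map sigma^2 + 1; the radical is described by its values. *)
Definition tau (s : nat) y : K := frob (s + s) y + y.

Lemma in_radical s a y : frob s a = a -> a != 0 ->
  (y \in radical N s a) = (a * tau s y ^+ 4 == tau s y).
Proof.
move=> fa a0; have KE x : x \in Fix N by rewrite (FixN cardK) inE.
have odd1 : odd (N %/ N) by rewrite divnn N_gt0.
apply/(radicalP cardK N_gt0 (dvdnn N) odd1 y fa a0 (KE a))/eqP => [[]//|];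
  split=> //.
Qed.

(** The kernel of tau s lies in the radical, and it is the field fixed by
frob (s + s). *)
Lemma card_radical s a : frob s a = a -> a != 0 ->
  #|radical N s a| = (#|tau s @: radical N s a| * 2 ^ gcdn (s + s) N)%N.
Proof.
move=> fa a0.
have tB : {in radical N s a &, forall x y, tau s (x - y) = tau s x - tau s y}.
  by move=> x y _ _; rewrite /tau !(opp2 cardK) (frobD cardK) addrACA.
have rz : zmod_closed (mem (radical N s a)).
  apply: (perp_zmod (@cubic_char_sqr K s a) (cubic_charD cardK s a)
    (polar_charDl cardK s a)).
  exact: (Fix_zmod cardK).
rewrite (card_additive_image rz tB); congr (_ * _)%N.
rewrite -(card_Fix cardK) ?gcdn_gt0 ?N_gt0 ?orbT ?dvdn_gcdr // -(Fix_gcd cardK).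
apply: eq_card => y; rewrite [RHS]inE [LHS]inE in_radical //.
rewrite [tau s y == 0]addr_eq0 (opp2 cardK) andbC; case: eqP => //= fy.
by rewrite /tau fy (addxx cardK) expr0n mulr0 eqxx.
Qed.

Lemma card_radical_trivial s a : frob s a = a -> a != 0 ->
    (forall y, a * tau s y ^+ 4 = tau s y -> tau s y = 0) ->
  #|radical N s a| = (2 ^ gcdn (s + s) N)%N.
Proof.
move=> fa a0 triv; rewrite card_radical // (_ : imset _ _ = [set 0]) ?cards1
  ?mul1n //.
apply/setP => w; rewrite inE; apply/imsetP/eqP => [[y yR ->]|->].
  by move: yR; rewrite in_radical // => /eqP/triv.
have t0 : tau s 0 = 0 by rewrite /tau frob_0 addr0.
by exists 0; rewrite ?in_radical ?t0 // expr0n mulr0.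
Qed.

Variable om : K.
Hypothesis om_eq : om ^+ 2 = om + 1.

Lemma om_neq0 : om != 0.
Proof.
by apply/eqP => om0; move: om_eq; rewrite om0 expr0n add0r => /eqP; rewrite
  eq_sym oner_eq0.
Qed.

Lemma om3 : om ^+ 3 = 1.
Proof.
by rewrite exprS om_eq mulrDr -expr2 om_eq mulr1 addrAC (addxx cardK) add0r.
Qed.

Lemma frob2_om k : frob (k + k) om = om.
Proof.
rewrite addnn -mul2n (frob_mul) // -(frob_comp 1 1) !frob1 om_eq (sqrD2 cardK)
  om_eq expr1n.
by rewrite (add2K cardK).
Qed.

Lemma cube_roots w : w ^+ 3 = 1 -> [|| w == 1, w == om | w == om ^+ 2].
Proof.
move=> w3; have eq : (w + om) * (w + om ^+ 2) = w ^+ 2 + w + 1.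
  transitivity (w ^+ 2 + (om + om ^+ 2) * w + om ^+ 3); first by ring.
  by rewrite om3 om_eq; ring2 cardK.
have : (w + 1) * ((w + om) * (w + om ^+ 2)) = 0.
  rewrite eq; transitivity (w ^+ 3 + 1); first by ring2 cardK.
  by rewrite w3 (addxx cardK).
by move/eqP; rewrite !mulf_eq0 !addr_eq0 !(opp2 cardK).
Qed.

(** The nonzero solutions of a w^4 = w differ by cube roots of unity, which
frob (s + s) fixes; so a single y0 already provides preimages of all of them. *)
Lemma card_radical_full s a y0 : frob s a = a -> a != 0 ->
    tau s y0 != 0 -> a * tau s y0 ^+ 4 = tau s y0 ->
  #|radical N s a| = (4 * 2 ^ gcdn (s + s) N)%N.
Proof.
move=> fa a0 w0; set w := tau s y0 in w0 *; move=> aw.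
have aw3 : a * w ^+ 3 = 1 by apply: (mulIf w0); rewrite -mulrA -exprSr mul1r.
have tauM k : k \in [set 1; om; om ^+ 2] -> tau s (k * y0) = k * w.
  rewrite /tau frobM mulrDr !inE.
  by move=> /orP[/orP[]|] /eqP ->; rewrite ?frobX ?frob_1 ?frob2_om.
rewrite card_radical //; congr (_ * _)%N.
have -> : tau s @: radical N s a = [set 0; w; om * w; om ^+ 2 * w].
  apply/setP => v; apply/imsetP/idP => [[y yR ->]|].
    move: yR; rewrite in_radical // => /eqP aty.
    rewrite !inE; case: (eqVneq (tau s y) 0) => //= ty0.
    have aty3 : a * tau s y ^+ 3 = 1 by apply: (mulIf ty0); rewrite -mulrA
      -exprSr mul1r.
    have : (tau s y / w) ^+ 3 = 1.
      apply: (mulfI a0); rewrite mulr1 expr_div_n mulrA aty3 mul1r.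
      by apply: (mulIf (_ : w ^+ 3 != 0)); rewrite ?expf_neq0 // mulVf
        ?expf_neq0 ?aw3.
    move/cube_roots/or3P => -[] /eqP eq.
    - by rewrite -[tau s y](divfK w0) eq mul1r eqxx.
    - by rewrite -[tau s y](divfK w0) eq eqxx ?orbT.
    - by rewrite -[tau s y](divfK w0) eq eqxx ?orbT.
  have mem k : k \in [set 1; om; om ^+ 2] -> exists2 x, x \in radical N s a & k
    * w = tau s x.
    move=> kI; exists (k * y0); last by rewrite tauM.
    rewrite in_radical // tauM // exprMn mulrCA aw.
    have k3 : k ^+ 3 = 1.
      by move: kI; rewrite !inE => /orP[/orP[]|]/eqP ->; rewrite ?expr1n ?om3
        // exprAC om3 expr1n.
    by rewrite exprS k3 mulr1.
  rewrite !inE -!orbA => /or4P[]/eqP ->.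
  - have t0 : tau s 0 = 0 by rewrite /tau frob_0 addr0.
    by exists 0; rewrite ?in_radical ?t0 // expr0n mulr0.
  - by rewrite -[w]mul1r; apply: mem; rewrite !inE eqxx.
  - by apply: mem; rewrite !inE eqxx ?orbT.
  - by apply: mem; rewrite !inE eqxx ?orbT.
have om1 : om != 1.
  by apply/eqP => o1; move: om_eq; rewrite o1 expr1n (addxx cardK) => /eqP;
    rewrite oner_eq0.
have neq k l : (k * w == l * w) = (k == l) by rewrite (inj_eq (mulIf w0)).
have -> : [set 0; w; om * w; om ^+ 2 * w] = [set 0 * w; 1 * w; om * w; om ^+ 2
  * w].
  by rewrite mul0r mul1r.
rewrite -!setUA !cardsU1 cards1 !inE !neq om_eq.
have succ_neq x : (x == x + 1) = false.
  by rewrite -{1}[x]addr0 (inj_eq (addrI x)) eq_sym oner_eq0.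
rewrite succ_neq eq_sym oner_eq0 (eq_sym 0 om) (negPf om_neq0) (eq_sym 1 om)
  (negPf om1).
by rewrite eq_sym addr_eq0 (opp2 cardK) (negPf om1) eq_sym -subr_eq0 addrK
  (negPf om_neq0).
Qed.

End Radical.

(** * Even r *)

Section Common.
Variables (K : finFieldType) (N : nat).
Implicit Types (a x y z w : K).
Hypothesis cardK : #|K| = (2 ^ N)%N.

Lemma exists_omega : ~~ odd N -> exists om : K, om ^+ 2 = om + 1.
Proof.
move=> evN; have dvdN : (2 * 1 %| N)%N by rewrite muln1 dvdn2.
have [om _ eq] := trace_onto cardK (ltnSn 0) dvdN (Fix1 K 1).
exists om; rewrite -frob1 -eq addrA (addxx cardK) add0r //.
Qed.

Lemma frob_shift r k y w : frob r w = w -> frob r y = y + w ->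
  frob (r * k) y = y + w *+ odd k.
Proof.
move=> fw fy; elim: k => [|k IH]; first by rewrite muln0 frob0 addr0.
rewrite mulnS -frob_comp IH (frobD cardK) fy -addrA /=; congr (_ + _).
by case: (odd k); rewrite /= ?mulr1n ?mulr0n ?fw ?frob_0 ?addr0 ?(addxx cardK).
Qed.

(** With w = tau s y, iterating frob (s + s) adds w to y each time.  An odd number k
of iterations adds w in total, and here it is the identity. *)
Lemma tau_fixed_eq0 s k y : odd k -> (N %| (s + s) * k)%N ->
  frob (s + s) (tau s y) = tau s y -> tau s y = 0.
Proof.
move=> oddk dvd ft; have fy : frob (s + s) y = y + tau s y.
  by rewrite /tau addrCA (addxx cardK) addr0.
have := frob_shift k ft fy; rewrite oddk mulr1n (frob_dvd dvd (frobN cardK y)).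
by rewrite -{1}[y]addr0 => /addrI.
Qed.

(** The quotient of w by 1 / b is a cube root of unity. *)
Lemma cube_root_fixed s a b w : frob (s + s) b = b -> a = b ^+ 3 -> a != 0 ->
  ~~ odd N -> a * w ^+ 4 = w -> frob (s + s) w = w.
Proof.
move=> fb ab a0 evN aw; have [om om_eq] := exists_omega evN.
case: (eqVneq w 0) => [->|w0]; first by rewrite frob_0.
have b0 : b != 0 by apply: contraNneq a0 => b0; rewrite ab b0 expr0n.
have : (b * w) ^+ 3 = 1.
  by rewrite exprMn -ab; apply: (mulIf w0); rewrite -mulrA -exprSr mul1r.
move/(cube_roots cardK om_eq) => eq; apply: (mulfI b0); rewrite -{1}fb -frobM.
by case/or3P: eq => /eqP ->; rewrite ?frobX ?frob_1 ?(frob2_om cardK).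
Qed.

End Common.

Lemma dvd3_4X k : (3 %| (2 ^+ (2 * k) - 1 : int)%R)%Z.
Proof. by rewrite exprM subrX1 dvdz_mulr. Qed.

(** The powers of 4 are 1 modulo 3, which decides between the two square roots. *)
Lemma sqrt_mod3_small (z : int) k :
  (3 %| z - 1)%Z -> z ^+ 2 = (2 ^ (2 * (2 * k)))%N%:Z -> z = 2 ^+ (2 * k).
Proof.
have := dvd3_4X k; set X : int := 2 ^+ (2 * k) => dX dz eq.
have : z ^+ 2 = X ^+ 2 by rewrite eq /X -exprM mulnC -natz natrX.
move/eqP; rewrite eqf_sqr => /orP[/eqP //|/eqP zX].
move: dz dX; rewrite zX => /dvdzP[u hu] /dvdzP[v hv]; lia.
Qed.

Lemma sqrt_mod3_large (z : int) k : (3 %| z - 1)%Z ->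
  z ^+ 2 = (4 * 2 ^ (2 * (2 * k)))%N%:Z -> z = - 2 ^+ (2 * k + 1).
Proof.
have := dvd3_4X k; rewrite exprD; set X : int := 2 ^+ (2 * k) => dX dz eq.
have : z ^+ 2 = (X * 2) ^+ 2.
  rewrite eq PoszM exprMn /X -exprM mulnC -[Posz (2 ^ _)]natz natrX; ring.
move/eqP; rewrite eqf_sqr => /orP[/eqP zX|/eqP //].
move: dz dX; rewrite zX => /dvdzP[u hu] /dvdzP[v hv]; lia.
Qed.

Section EvenR.
Variables (K : finFieldType) (r n : nat).
Implicit Types (a x y z w : K).
Hypotheses (r_gt0 : (0 < r)%N) (n_gt0 : (0 < n)%N) (r_even : ~~ odd r).
Hypothesis cardK : #|K| = (2 ^ (r * n))%N.
Let N := (r * n)%N.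
Let N_gt0 : (0 < N)%N. Proof. by rewrite muln_gt0 r_gt0. Qed.
Let N_even : ~~ odd N. Proof. by rewrite oddM (negPf r_even). Qed.
Variable a : K.
Hypotheses (fa : frob r a = a) (a0 : a != 0).

(** As r is even, frob r fixes om, and the form picks up the factor om ^+ 3 = 1 when
x is multiplied by om; the orbits other than {0} have three elements. *)
Lemma cubic_sum_mod3 : (3 %| cubic_sum N r a - 1)%Z.
Proof.
have [om om_eq] := exists_omega cardK N_even.
have om_fr k : ~~ odd k -> frob k om = om.
  move=> evk; rewrite -(odd_double_half k) (negPf evk) add0n -addnn.
  exact: (frob2_om cardK om_eq).
have om3 := om3 cardK om_eq.
have inF x : x \in Fix N by rewrite (FixN cardK) inE.
have := @sum_fixed_mod K (fun x => om * x) 3 isT (Fix N) (cubic_char r a).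
rewrite -/(cubic_sum N r a).
have -> : \sum_(x in Fix N | om * x == x) cubic_char r a x = 1.
  rewrite (big_pred1 0) => [|x].
    exact: cubic_char0.
  rewrite inF /= -subr_eq0 -{2}[x]mul1r -mulrBl mulf_eq0 (opp2 cardK).
  by rewrite -om_eq expf_eq0 (negPf (om_neq0 om_eq)).
apply=> // [x _|x|x _] /=.
- by rewrite !mulrA -expr2 -exprSr om3 mul1r.
- exact: cubic_char_sqr.
- rewrite /cubic_char /cubic frobM om_fr //; congr (psi (a * _)).
  transitivity (om ^+ 3 * (x * frob r x ^+ 2 + x ^+ 2 * frob r x)); first by
    ring.
  by rewrite om3 mul1r.
Qed.

Lemma cubic_sum_sqr_radical :
  cubic_sum N r a ^+ 2 = (2 ^ N * #|radical N r a|)%N%:Z.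
Proof.
have S0 : cubic_sum N r a != 0.
  by apply/eqP => S0; have := cubic_sum_mod3; rewrite S0.
have := cubic_sum_sqr cardK N r a; rewrite (card_Fix cardK N_gt0 (dvdnn N)).
case: [forall _ in _, _]; first by rewrite mulr1 PoszM.
by rewrite !mulr0 => /eqP; rewrite expf_eq0 (negPf S0).
Qed.

(** The exponent of 2 in |K| |W| is a multiple of 4 as r is even, so that the square
root is a power of 4. *)
Lemma half_dim_even : exists k,
  (r * (n + gcdn 2 n) %/ 2 = 2 * k /\ N + gcdn (r + r) N = 2 * (2 * k))%N.
Proof.
have -> : gcdn (r + r) N = (r * gcdn 2 n)%N by rewrite addnn -muln2 /N
  -muln_gcdr.
rewrite /N -mulnDr; have /dvdnP[j ->] : (2 %| r)%N by rewrite dvdn2.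
have /dvdnP[i ->] : (2 %| n + gcdn 2 n)%N.
  rewrite dvdn2 oddD; case: (boolP (odd n)) => on.
    by rewrite (_ : gcdn 2 n = 1%N) //; apply/eqP; rewrite -/(coprime 2 n)
      coprime2n.
  by rewrite (gcdn_idPl _) ?dvdn2.
exists (j * i)%N; split; last by lia.
by rewrite (_ : j * 2 * (i * 2) = 2 * (j * i) * 2)%N ?mulnK //; lia.
Qed.

Lemma cubic_sum_small_radical : #|radical N r a| = (2 ^ gcdn (r + r) N)%N ->
  cubic_sum N r a = 2 ^+ (r * (n + gcdn 2 n) %/ 2)%N.
Proof.
move=> eq; have [k [-> dim]] := half_dim_even.
apply: sqrt_mod3_small; first exact: cubic_sum_mod3.
by rewrite cubic_sum_sqr_radical eq -expnD dim.
Qed.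

Lemma cubic_sum_large_radical : #|radical N r a| = (4 * 2 ^ gcdn (r + r) N)%N ->
  cubic_sum N r a = - 2 ^+ (r * (n + gcdn 2 n) %/ 2 + 1)%N.
Proof.
move=> eq; have [k [-> dim]] := half_dim_even.
apply: sqrt_mod3_large; first exact: cubic_sum_mod3.
by rewrite cubic_sum_sqr_radical eq mulnCA -expnD dim.
Qed.

Section Cube.
Variable b : K.
Hypotheses (ab : a = b ^+ 3) (fb : frob r b = b).

Let fb2 : frob (r + r) b = b. Proof. by rewrite -frob_comp !fb. Qed.

(** Either n or n / 2 is odd, and that many iterations of frob (r + r) are trivial. *)
Lemma radical_cube_small : ~~ (4 %| n)%N ->
  #|radical N r a| = (2 ^ gcdn (r + r) N)%N.
Proof.
move=> n4; apply: (card_radical_trivial cardK) => // y aty.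
have ft := cube_root_fixed cardK fb2 ab a0 N_even aty.
have [k ok dvd] : exists2 k, odd k & (N %| (r + r) * k)%N.
  case: (boolP (odd n)) => on.
    by exists n => //; rewrite /N mulnDl dvdn_addl.
  exists n./2; first by lia.
  by rewrite addnn -muln2 /N -mulnA mul2n -[X in (r * X %| _)%N](even_halfK on).
exact: (tau_fixed_eq0 cardK ok dvd ft).
Qed.

(** By additive Hilbert 90 over the field fixed by frob (r + r), 1 / b is a value of
tau r. *)
Lemma radical_cube_large : (4 %| n)%N ->
  #|radical N r a| = (4 * 2 ^ gcdn (r + r) N)%N.
Proof.
move=> /dvdnP[j nj]; have [om om_eq] := exists_omega cardK N_even.
have b0 : b != 0 by apply: contraNneq a0 => b0; rewrite ab b0 expr0n.
have bF : b^-1 \in Fix (r + r) by apply/FixP; rewrite frobV fb2.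
have rr_gt0 : (0 < r + r)%N by rewrite addn_gt0 r_gt0.
have dvd : (2 * (r + r) %| N)%N.
  by apply/dvdnP; exists j; rewrite /N nj; lia.
have [y _ ty] := trace_onto cardK rr_gt0 dvd bF.
have {}ty : tau r y = b^-1 by rewrite -ty addrC.
apply: (card_radical_full cardK N_gt0 om_eq fa a0 (y0 := y)).
  by rewrite ty invr_eq0.
by rewrite ty ab (exprS _ 3) mulrCA exprVn mulfV ?expf_neq0 // mulr1.
Qed.

End Cube.

Section NonCube.
Variable m : nat.
Hypotheses (cardF : (3 * m = (2 ^ r).-1)%N) (am : a ^+ m != 1).
Let d := a ^+ m.

Let fd : frob r d = d. Proof. by rewrite /d frobX fa. Qed.

Let d3 : d ^+ 3 = 1.
Proof.
rewrite /d -exprM mulnC cardF; apply: (mulfI a0).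
by rewrite mulr1 -exprS prednK ?expn_gt0 // -frobE fa.
Qed.

(** Since 2^r = 1 + 3m, frob r multiplies a cube root w of 1 / a by a^(-m), which is
a primitive cube root of unity. *)
Lemma frob_cube_root w : a * w ^+ 3 = 1 -> frob r w * d = w.
Proof.
move=> aw; rewrite frobE -(prednK (_ : (0 < 2 ^ r)%N)) ?expn_gt0 //.
by rewrite exprS -cardF exprM -mulrA -exprMn mulrC -(mulrC a) aw expr1n mul1r.
Qed.

(** After n steps of frob_cube_root a solution w would satisfy w d^n = w, which
forces 3 to divide n. *)
Lemma radical_noncube_small : ~~ (3 %| n)%N ->
  #|radical N r a| = (2 ^ gcdn (r + r) N)%N.
Proof.
move=> n3; apply: (card_radical_trivial cardK) => // y aty.
move: (tau r y) aty => w aw; apply/eqP/negPn/negP => w0.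
have aw3 : a * w ^+ 3 = 1 by apply: (mulIf w0); rewrite -mulrA -exprSr mul1r.
have step k : frob (r * k) w * d ^+ k = w.
  elim: k => [|k IH]; first by rewrite muln0 frob0 mulr1.
  rewrite mulnSr -frob_comp exprSr (mulrC (d ^+ k)) mulrA.
  by rewrite -{1}(frob_mul k fd) -frobM frob_cube_root.
have := step n; rewrite -/N (frobN cardK) -{2}[w]mulr1 => /(mulfI w0) dn.
have : d ^+ gcdn 3 n = 1.
  have [i j eq _] := egcdnP n (isT : (0 < 3)%N).
  have := exprD d (j * n) (gcdn 3 n); rewrite -eq mulnC exprM d3 mulnC exprM dn.
  by rewrite !expr1n mul1r => <-.
rewrite (_ : gcdn 3 n = 1%N); first by move/eqP; rewrite (negPf am).
by apply/eqP; rewrite -/(coprime 3 n) prime_coprime.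
Qed.

(** The exponent (|K| - 1) / 3 is m times the sum T of the (2^r)^i for i < n, which is
n modulo 3; hence a^((|K| - 1) / 3) = d^T = 1 and a is a cube in K.  If
a w^3 = 1, then frob (r + r) multiplies d w by d^(-2) = d, whence
tau r (d w) = (d^2 + d) w = w. *)
Lemma radical_noncube_large : (3 %| n)%N ->
  #|radical N r a| = (4 * 2 ^ gcdn (r + r) N)%N.
Proof.
move=> n3; have [om om_eq] := exists_omega cardK N_even.
have [T eqT T3] : exists2 T, ((2 ^ N).-1 = T * (2 ^ r).-1)%N & (3 %| T)%N.
  exists (\sum_(i < n) (2 ^ r) ^ i)%N.
    by rewrite /N expnM predn_exp mulnC.
  have mod1 i : ((2 ^ r) ^ i = 1 %[mod 3])%N.
    have : (3 %| (2 ^ r).-1)%N by rewrite -cardF dvdn_mulr.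
    rewrite -subn1 -eqn_mod_dvd ?expn_gt0 // => /eqP e.
    by rewrite -modnXm e modnXm exp1n.
  rewrite /dvdn -modn_summ (eq_bigr (fun=> 1%N)) => [|i _]; last by rewrite
    mod1.
  by rewrite sum1_card card_ord.
have [c ac] : exists c, a = c ^+ 3.
  apply: (@cube_criterion K (T * m)) => //.
    by rewrite cardK eqT -cardF mulnCA.
  by case/dvdnP: T3 => j ->; rewrite mulnC exprM mulnC exprM d3 expr1n.
have c0 : c != 0 by apply: contraNneq a0 => c0; rewrite ac c0 expr0n.
pose w := c^-1; have aw3 : a * w ^+ 3 = 1 by rewrite ac exprVn mulfV ?expf_neq0.
have d0 : d != 0 by rewrite expf_neq0.
have dd : d ^+ 2 + d = 1.
  apply/eqP; rewrite -subr_eq0 (opp2 cardK).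
  have /eqP : (d + 1) * (d ^+ 2 + d + 1) = 0.
    transitivity (d ^+ 3 + 1); last by rewrite d3 (addxx cardK).
    by move: d => u; ring2 cardK.
  rewrite mulf_eq0 addr_eq0 (opp2 cardK) => /orP[|//].
  by rewrite addr_eq0 (opp2 cardK) => d1; case/negP: am.
have tw : tau r (d * w) = w.
  have fw := frob_cube_root aw3.
  have : tau r (d * w) * d ^+ 2 = w * d ^+ 2.
    rewrite /tau -frob_comp !frobM !fd.
    have := congr1 (frob r) fw; rewrite frobM fd => ffw.
    transitivity ((frob r (frob r w) * d) * d ^+ 2 + w * d ^+ 3); first by ring.
    transitivity (frob r w * d * d + w * d ^+ 3); first by rewrite ffw; ring.
    by rewrite fw d3 -[X in w * X]dd; ring2 cardK.
  by move/(mulIf (expf_neq0 2 d0)).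
apply: (card_radical_full cardK N_gt0 om_eq fa a0 (y0 := d * w)).
  by rewrite tw invr_eq0.
by rewrite tw (exprS _ 3) mulrCA aw3 mulr1.
Qed.
End NonCube.

End EvenR.

(** * Odd r and odd n *)

(** The Jacobi symbol (2/n), meaningful for odd n. *)
Definition jacobi2 (n : nat) : int :=
  if (n %% 8 == 1)%N || (n %% 8 == 7)%N then 1 else -1.

Lemma jacobi2_sqr n : jacobi2 n ^+ 2 = 1.
Proof. by rewrite /jacobi2; case: ifP. Qed.

Lemma jacobi2M m n : odd m -> odd n -> jacobi2 (m * n) = jacobi2 m * jacobi2 n.
Proof.
move=> om on; rewrite /jacobi2 -modnMml -modnMmr.
have : odd (m %% 8) by rewrite odd_mod.
have : odd (n %% 8) by rewrite odd_mod.
have := ltn_pmod m (isT : 0 < 8)%N; have := ltn_pmod n (isT : 0 < 8)%N.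
by move: (m %% 8)%N (n %% 8)%N; do 8?[case=> //]; do 8?[case=> //].
Qed.

Lemma odd_mod8 l : odd l ->
  [\/ l %% 8 = 1, l %% 8 = 3, l %% 8 = 5 | l %% 8 = 7]%N.
Proof.
move=> ol; have : odd (l %% 8) by rewrite odd_mod.
have := ltn_pmod l (isT : 0 < 8)%N.
move: (l %% 8)%N; do 8?[case=> //]; by constructor.
Qed.

(** The second supplement to quadratic reciprocity.  In the field of l^2 elements
let u be a primitive eighth root of unity; then y = u - u^3 = u + 1/u has square
2, so 2^((l-1)/2) = y^l / y, and y^l = u^l - u^(3l) depends on l modulo 8. *)
Lemma two_power_mod_prime l : prime l -> odd l ->
  (l %| 2 ^+ l./2 - jacobi2 l)%Z.
Proof.
move=> l_pr ol; have l_gt0 := prime_gt0 l_pr.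
have [L charL cardL] := pPrimePowerField l_pr (isT : 0 < 2)%N.
have [z zP] := finField_prim_root L; rewrite cardL in zP.
have l8 : (8 %| (l ^ 2).-1)%N.
  rewrite -subn1 -eqn_mod_dvd ?expn_gt0 ?l_gt0 // -modnXm.
  by case: (odd_mod8 ol) => ->.
have [u u4] : exists u : L, u ^+ 4 = -1.
  pose u := z ^+ ((l ^ 2).-1 %/ 8); exists u.
  have u8 : (u ^+ 4) ^+ 2 = 1.
    by rewrite -exprM -[(4 * 2)%N]/8%N /u -exprM divnK // (prim_expr_order zP).
  move/eqP: u8; rewrite sqrf_eq1 => /orP[|/eqP //].
  rewrite /u -exprM -(prim_order_dvd zP).
  have := prim_order_gt0 zP; case/dvdnP: l8 => j ->; rewrite mulnK //.
  by case: j => // j _; rewrite dvdn_pmul2l.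
pose y := u - u ^+ 3.
have y2 : y ^+ 2 = 2.
  transitivity (u ^+ 2 * (1 + u ^+ 4) - 2 * u ^+ 4); first by rewrite /y; ring.
  by rewrite u4 subrr mulr0; ring.
have l2 : 2 != 0 :> L.
  rewrite -(dvdn_pcharf charL); apply/negP => /(dvdn_leq (isT : 0 < 2)%N).
  by have := prime_gt1 l_pr; move: ol; case: (l) => [|[|[|]]].
have y0 : y != 0 by apply: contraNneq l2 => y0; rewrite -y2 y0 expr0n.
have yl : y ^+ l = (jacobi2 l)%:~R * y.
  rewrite /y -(pFrobenius_autE charL) rmorphB rmorphXn /= !pFrobenius_autE.
  have red k : u ^+ (k + 8) = u ^+ k.
    by rewrite exprD (exprM u 4 2) u4 sqrrN expr1n mulr1.
  have -> : u ^+ l = u ^+ (l %% 8).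
    by rewrite {1}(divn_eq l 8) exprD mulnC exprM (exprM u 4 2) u4 sqrrN
      !expr1n mul1r.
  by rewrite /jacobi2; case: (odd_mod8 ol) => -> /=; ring: u4.

rewrite (dvdz_pcharf charL); apply/eqP/(mulIf y0); rewrite mul0r rmorphB mulrBl
  -yl.
rewrite -[in X in _ - X](odd_double_half l) ol -mul2n exprD exprM y2 rmorphXn.
by rewrite mulrC subrr.
Qed.

Lemma sign_mod_inj (l : nat) (a b : int) :
  (2 < l)%N -> (l %| a - b)%Z -> a ^+ 2 = 1 -> b ^+ 2 = 1 -> a = b.
Proof.
move=> l_gt2 dvd /eqP; rewrite sqrf_eq1 => ha /eqP; rewrite sqrf_eq1.
have l2 : ~~ (l %| 2)%N by apply/negP => /(dvdn_leq (isT : 0 < 2)%N); rewrite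
  leqNgt l_gt2.
by move: ha => /orP[]/eqP ea /orP[]/eqP eb; move: dvd; rewrite ea eb // dvdzE
  /= (negPf l2).
Qed.

Section OddOdd.
Variables (K : finFieldType) (r n : nat).
Implicit Types (x y z w : K).
Hypotheses (r_gt0 : (0 < r)%N) (r_odd : odd r) (n_odd : odd n).
Hypothesis cardK : #|K| = (2 ^ (r * n))%N.
Let N := (r * n)%N.
Let n_gt0 : (0 < n)%N. Proof. by case: (n) n_odd. Qed.
Let N_gt0 : (0 < N)%N. Proof. by rewrite muln_gt0 r_gt0. Qed.
Local Notation subsum m := (cubic_sum (r * m) r (1 : K)).

Lemma cubic_char_Fix s x : frob s x = x -> cubic_char s 1 x = 1.
Proof.
by move=> fx; rewrite /cubic_char /cubic fx -exprS -exprSr (addxx cardK) mulr0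
  psi0.
Qed.

(** Here K has odd degree over F_2 and does not contain F_4, so w^4 = w leaves w = 0
or 1, and w = 1 is excluded by tau_fixed_eq0; then y is fixed by frob (r + r)
and by an odd power of frob r, hence by frob r. *)
Lemma radical_odd m : (m %| n)%N -> radical (r * m) r 1 = @Fix K r.
Proof.
move=> mn; have m_odd : odd m by apply: dvdn_odd mn n_odd.
have e_gt0 : (0 < r * m)%N by rewrite muln_gt0 r_gt0; case: (m) m_odd.
have e_dvd : (r * m %| N)%N by rewrite dvdn_pmul2l.
have deg_odd : odd (N %/ (r * m)).
  rewrite divnMl //; apply: dvdn_odd n_odd.
  by apply/dvdnP; exists m; rewrite mulnC divnK.
apply/setP => y.
have rP := radicalP cardK e_gt0 e_dvd deg_odd y (frob_1 K r) (oner_neq0 K)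
  (Fix1 K _).
apply/rP/FixP => [[/FixP fmy]|fy]; last first.
  split; first by apply/FixP/frob_mul.
  by rewrite -frob_comp !fy (addxx cardK) expr0n mulr0.
rewrite mul1r -/(tau r y) => w4.
have ww : frob (r + r) (tau r y) = tau r y.
  rewrite addnn -mul2n frob_mul //.
  by rewrite -(frob_comp 1 1) !frob1 -exprM.
have dvd : (N %| (r + r) * n)%N by rewrite mulnDl dvdn_addl.
have /(add2_eq0 cardK) f2y := tau_fixed_eq0 cardK n_odd dvd ww.
move: fmy; rewrite -(odd_double_half m) m_odd mulnDr muln1 -frob_comp -mul2n
  mulnA muln2 -addnn.
by rewrite (frob_mul _ f2y).
Qed.

Lemma cubic_sum_sqr_odd m : (m %| n)%N -> subsum m ^+ 2 = 2 ^+ (r * m.+1).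
Proof.
move=> mn; have e_dvd : (r * m %| N)%N by rewrite dvdn_pmul2l.
have m_gt0 : (0 < m)%N by apply: dvdn_gt0 mn.
rewrite (cubic_sum_sqr cardK) radical_odd // (card_Fix cardK _ e_dvd) ?muln_gt0
  ?r_gt0 //.
rewrite (card_Fix cardK r_gt0) ?dvdn_mulr //.
have -> : [forall x in @Fix K r, cubic_char r 1 x == 1].
  by apply/forall_inP => x /FixP/cubic_char_Fix ->.
by rewrite mulr1 -PoszM -expnD -natz natrX mulnS addnC.
Qed.

(** Powers of frob preserve psi and the form; frob (r * k) has order l on
Fix (r * (k * l)), and fixes exactly Fix (r * k). *)
Lemma cubic_sum_orbit k l : prime l -> (k * l %| n)%N ->
  (l %| subsum (k * l) - subsum k)%Z.
Proof.
move=> l_pr kl; have := @sum_fixed_mod K (frob (r * k)) l l_pr (Fix (r * (k *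
  l))) (cubic_char r 1).
have -> : \sum_(x in @Fix K (r * (k * l)) | frob (r * k) x == x) cubic_char r 1
  x = subsum k.
  rewrite /cubic_sum; apply: eq_bigl => x; rewrite !inE andbC; case: eqP => //=
    fx.
  by rewrite mulnA frob_mul // eqxx.
apply.
- by move=> x; apply: Fix_frob.
- move=> x /FixP fx; rewrite -[RHS]fx mulnA.
  by elim: (l) => [|j IH]; rewrite ?muln0 ?frob0 //= IH frob_comp -mulnS.
- exact: cubic_char_sqr.
- move=> x _; rewrite /cubic_char -[RHS](psi_frob cardK (r * k)); congr psi.
  by rewrite /cubic !mul1r (frobD cardK) !(frobX, frobM) (frobC r).
Qed.

(** The square of the sum leaves only the sign open.  Write m = k l with l prime:
the sums for m and k agree modulo l, and their absolute values differ by the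
factor (2^((l-1)/2))^(r k), which is (2/l) modulo l since r k is odd. *)
Lemma cubic_sum_odd m : (m %| n)%N -> subsum m = jacobi2 m * 2 ^+ (r * m.+1./2).
Proof.
elim/ltn_ind: m => m IH mn; have m_odd : odd m by apply: dvdn_odd mn n_odd.
have [m1|m1] := leqP m 1.
  have -> : m = 1%N by move: m_odd m1; case: (m) => [|[]].
  rewrite /cubic_sum muln1 mul1r (eq_bigr (fun=> 1)) => [|x /FixP]; last exact:
    cubic_char_Fix.
  rewrite sumr_const (card_Fix cardK) ?dvdn_mulr // natrX //.
have l_pr := pdiv_prime m1; have [k mk] := dvdnP (pdiv_dvd m).
move: (pdiv m) l_pr mk => l l_pr mk; rewrite {m}mk in IH mn m_odd m1 *.
have [k_odd l_odd] : odd k /\ odd l by apply/andP; rewrite -oddM.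
have k_gt0 : (0 < k)%N by case: (k) k_odd.
have kn : (k %| n)%N by apply: dvdn_trans mn; apply: dvdn_mulr.
have Sk := IH k (ltn_Pmulr (prime_gt1 l_pr) k_gt0) kn.
have half : ((k * l).+1./2 = k.+1./2 + l./2 * k)%N.
  have := odd_double_half k; have := odd_double_half l; rewrite k_odd l_odd.
  move: k./2 l./2 => i j <- <-.
  rewrite (_ : _.+1 = (j * (true + i.*2) + i.+1).*2)%N; last by rewrite
    -!muln2; nia.
  by rewrite doubleK addnC /= doubleK.
set d := jacobi2 k * jacobi2 l.
have := cubic_sum_orbit l_pr mn; have := cubic_sum_sqr_odd mn; rewrite Sk
  jacobi2M // -/d.
have -> : (r * (k * l).+1 = r * (k * l).+1./2 * 2)%N.
  rewrite -mulnA muln2; congr (_ * _)%N.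
  by rewrite -[LHS]odd_double_half /= m_odd.
rewrite exprM half mulnDr (mulnCA r l./2) exprD (exprM _ l./2).
set Y : int := 2 ^+ (r * k.+1./2); set H : int := 2 ^+ l./2.
have H_mod : (l %| H ^+ (r * k) - jacobi2 l)%Z.
  have -> : jacobi2 l = jacobi2 l ^+ (r * k).
    rewrite -(odd_double_half (r * k)) oddM r_odd k_odd exprD -mul2n exprM.
    by rewrite jacobi2_sqr expr1n mulr1.
  by rewrite subrXX dvdz_mulr // two_power_mod_prime.
have l_gt2 : (2 < l)%N by have := prime_gt1 l_pr; move: l_odd; case: (l) =>
  [|[|[|]]].
have YX : coprimez l Y.
  by rewrite /Y coprimezXr // coprimezE /= coprimen2.
move/eqP; rewrite eqf_sqr => /orP hS dvd.
have [e e2 eqS] : exists2 e : int, e ^+ 2 = 1 & subsum (k * l) = e * (Y * H ^+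
  (r * k)).
  by case: hS => /eqP ->; [exists 1 | exists (-1)]; rewrite ?mul1r ?mulN1r.
have : (l %| Y * (e * jacobi2 l - jacobi2 k))%Z.
  rewrite [X in (_ %| X)%Z](_ : _ = (subsum (k * l) - jacobi2 k * Y)
    - e * Y * (H ^+ (r * k) - jacobi2 l)); last by rewrite eqS; ring.
  by rewrite rpredB // dvdz_mull.
rewrite Gauss_dvdzr // => /(sign_mod_inj l_gt2) ejl; rewrite eqS /d -ejl.
  by rewrite -(mulrA e) -expr2 jacobi2_sqr mulr1.
- by rewrite exprMn e2 jacobi2_sqr.
- exact: jacobi2_sqr.
Qed.

End OddOdd.

(** * Isotropic subspaces in a quadratic extension *)

Section QuadraticExtension.
Variables (K : finFieldType) (e : nat).
Implicit Types (x y z k l : K).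
Hypothesis cardK : #|K| = (2 ^ (2 * e))%N.
Hypothesis e_gt0 : (0 < e)%N.
Variable theta : K.
Hypothesis theta_bar : frob e theta = theta + 1.

(** Every element of Fix e has the form y + frob e y, and psi does not distinguish
y from frob e y. *)
Lemma psi_half x : x \in Fix e -> psi x = 1.
Proof.
move=> xF; have [y _ <-] := trace_onto cardK e_gt0 (dvdnn _) xF.
by rewrite (psiD cardK) (psi_frob cardK) -expr2 psi_sqr.
Qed.

(** As psi is trivial on Fix e, the character of order two of that subfield is a twist
of psi; psi is recovered by composing it with the trace to Fix e [psi_chi]. *)
Definition chi x : int := psi (theta * x).

Lemma chiD x y : chi (x + y) = chi x * chi y.
Proof. by rewrite /chi mulrDr (psiD cardK). Qed.

Definition norm_theta : K := theta ^+ 2 + theta.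
Local Notation c := norm_theta.

Lemma norm_theta_in : c \in Fix e.
Proof.
by apply/FixP; rewrite /c (frobD cardK) frobX theta_bar; ring2 cardK.
Qed.

(** The element y + theta (y + frob e y) is fixed by frob e, so psi is 1 on it. *)
Lemma psi_chi y : psi y = chi (y + frob e y).
Proof.
suff yF : y + theta * (y + frob e y) \in Fix e.
  rewrite -[LHS]mulr1 -(psi_half yF) (psiD cardK) mulrA -expr2 psi_sqr mul1r.
  by [].
have fey : frob e (frob e y) = y by rewrite frob_comp addnn -mul2n (frobN
  cardK).
apply/FixP; rewrite !(frobD cardK) frobM theta_bar (frobD cardK) fey.
by ring2 cardK.
Qed.

Lemma chi_sq x : x \in Fix e -> chi (x ^+ 2) = chi x.
Proof.
move=> xF; rewrite /chi -[RHS](psi_sq cardK) exprMn.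
have -> : theta * x ^+ 2 = c * x ^+ 2 + theta ^+ 2 * x ^+ 2 by rewrite /c;
  ring2 cardK.
rewrite (psiD cardK) psi_half ?mul1r //.
by rewrite FixM ?norm_theta_in // FixX.
Qed.

(** If theta * c = z^2 + z, then v = z + frob e z is an element of Fix e with
v^2 + v = c = theta^2 + theta, so theta would be v or v + 1. *)
Lemma chi_norm_theta : chi c = -1.
Proof.
have /eqP := psi_sqr (theta * c); rewrite sqrf_eq1 => /orP[]/eqP // /psiP[z zc].
pose v := z + frob e z.
have fez : frob e (frob e z) = z by rewrite frob_comp addnn -mul2n (frobN
  cardK).
have vF : v \in Fix e by apply/FixP; rewrite (frobD cardK) fez addrC.
have : v \in [set y | y ^+ 2 + y == c].
  rewrite inE; apply/eqP; transitivity (theta * c + frob e (theta * c)).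
    by rewrite -zc (frobD cardK) frobX /v; ring2 cardK.
  by rewrite frobM theta_bar (FixP _ _ norm_theta_in); ring2 cardK.
rewrite (AS_fiber cardK (erefl c)) !inE => vE.
have thF : frob e theta = theta.
  case/orP: vE => /eqP vE; move/FixP: vF; rewrite vE //.
  by rewrite (frobD cardK) frob_1 => /addIr.
by move: theta_bar; rewrite thF -{1}[theta]addr0 => /addrI/eqP; rewrite eq_sym
  oner_eq0.
Qed.

(** The kernel of chi on Fix e.  It contains every x + frob i x; values of chi are
computed below by writing elements as sums of such terms. *)
Definition Null := [set x in Fix e | chi x == 1].

Lemma NullP x : reflect (x \in Fix e /\ chi x = 1) (x \in Null).
Proof. by apply: (iffP setIdP) => -[xF /eqP cx]. Qed.

Lemma NullD x y : x \in Null -> y \in Null -> x + y \in Null.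
Proof.
move=> /NullP[xF cx] /NullP[yF cy]; apply/NullP; split; first exact: (FixD
  cardK).
by rewrite chiD cx cy.
Qed.

Lemma chi_frob i x : x \in Fix e -> chi (frob i x) = chi x.
Proof. by apply: (@chi_frob_in K e); apply: chi_sq. Qed.

Lemma Null_frob i x : x \in Fix e -> x + frob i x \in Null.
Proof.
move=> xF; apply/NullP; split; first by rewrite (FixD cardK) // Fix_frob.
by rewrite chiD chi_frob // -expr2 psi_sqr.
Qed.

Lemma Null_sq x : x \in Fix e -> x + x ^+ 2 \in Null.
Proof. by rewrite -frob1; apply: Null_frob. Qed.

Variable s : nat.
Local Notation d := (theta + frob s theta).
Local Notation c' := (frob s c).

Lemma shift_in : d \in Fix e.
Proof.
apply/FixP; rewrite (frobD cardK) frobC theta_bar (frobD cardK) frob_1.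
by ring2 cardK.
Qed.

Lemma shift_sqr : c' = d ^+ 2 + d + c.
Proof. by rewrite /c (frobD cardK) frobX; ring2 cardK. Qed.

Lemma cubic_char_theta k : k \in Fix e ->
  cubic_char s 1 (theta * k) = chi (k * frob s k ^+ 2 * (d + c' + 1)
                           + k ^+ 2 * frob s k * (d + c + 1)).
Proof.
move=> /FixP kF; rewrite /cubic_char psi_chi; congr chi.
rewrite /cubic !mul1r !(frobD cardK) !(frobX, frobM) (frobC e s k) kF (frobC e
  s theta).
rewrite theta_bar !(frobD cardK) frob_1 ?frobX.
rewrite /norm_theta; move: (frob s theta) (frob s k) => t' k'; ring2 cardK.
Qed.

Lemma polar_char_theta k l : k \in Fix e -> l \in Fix e ->
  polar_char s 1 (theta * k) (theta * l)
  = chi ((k * frob s l ^+ 2 + l * frob s k ^+ 2) * (d + c' + 1)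
         + (k ^+ 2 * frob s l + l ^+ 2 * frob s k) * (d + c + 1)).
Proof.
move=> /FixP kF /FixP lF; rewrite /polar_char psi_chi; congr chi.
rewrite /polar /norm_theta !mul1r !(frobD cardK) !(frobX, frobM) !(frobC e s)
  kF lF.
rewrite theta_bar !(frobD cardK) frob_1 ?frobX.
rewrite /norm_theta; move: (frob s theta) (frob s k) (frob s l) => t' k' l';
  ring2 cardK.
Qed.

(** By psi_chi this is chi of the polarization of x and k in Fix e, where chi_polar
applies. *)
Lemma polar_char_half x k : x \in Fix e -> k \in Fix e ->
  tau s k ^+ 4 = tau s k -> polar_char s 1 x (theta * k) = 1.
Proof.
move=> xF kF tk; rewrite /polar_char psi_chi.
transitivity (chi (polar s 1 x k)).
  congr chi; move/FixP: (xF) => fx; move/FixP: (kF) => fk.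
  rewrite /polar !mul1r !(frobD cardK) !(frobX, frobM) !(frobC e s) fx fk.
  rewrite theta_bar (frobD cardK) frob_1.
  move: (frob s theta) (frob s k) (frob s x) => t' k' x'; ring2 cardK.
rewrite (@chi_polar K _ cardK e) ?Fix1 ?frob_1 //; last first.
- exact: chi_sq.
- by move=> u v _ _; apply: chiD.
by rewrite -/(tau s k) !mul1r tk (addxx cardK) mulr0 /chi mulr0 psi0.
Qed.

Variable r : nat.
Hypotheses (r_gt0 : (0 < r)%N) (r_e : (r %| e)%N) (r_s : (r %| s)%N).

(** A totally isotropic subspace as soon as frob s is trivial on Fix r. *)
Definition half_space := [set p.1 + theta * p.2 | p in setX (@Fix K e) (Fix r)].
Local Notation U := half_space.

Lemma half_spaceP y :
  reflect (exists x f, [/\ x \in Fix e, f \in Fix r & y = x + theta * f])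
    (y \in U).
Proof.
apply: (iffP imsetP) => [[[x f] /setXP[/= xF fF] ->]|[x [f [xF fF ->]]]].
  by exists x, f.
by exists (x, f); rewrite // in_setX xF.
Qed.

Lemma half_space_bar x f : x \in Fix e -> f \in Fix e ->
  (x + theta * f) + frob e (x + theta * f) = f.
Proof.
by move=> /FixP xF /FixP fF; rewrite (frobD cardK) frobM theta_bar xF fF; ring2
  cardK.
Qed.

Let r_sub f : f \in @Fix K r -> f \in Fix e. Proof. exact: Fix_dvd. Qed.

Lemma card_half_space : #|U| = (2 ^ e * 2 ^ r)%N.
Proof.
have r_N : (r %| 2 * e)%N by rewrite dvdn_mull.
rewrite card_in_imset ?cardsX ?(card_Fix cardK) ?dvdn_mull //.
move=> [x f] [y g] /setXP[/= xF fF] /setXP[/= yF gF] /= eq.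
have fg : f = g.
  by rewrite -(half_space_bar xF (r_sub fF)) eq (half_space_bar yF (r_sub gF)).
by move: eq; rewrite fg => /addIr ->.
Qed.

Lemma half_space_zmod : zmod_closed (mem U).
Proof.
apply: (zmod_closed2 cardK).
  by apply/half_spaceP; exists 0, 0; rewrite !Fix0 mulr0 addr0.
move=> _ _ /half_spaceP[x [f [xF fF ->]]] /half_spaceP[y [g [yF gF ->]]].
apply/half_spaceP; exists (x + y), (f + g).
by rewrite !(FixD cardK) // mulrDr addrACA.
Qed.

Lemma tau_base (f : K) : f \in Fix r -> tau s f = 0.
Proof.
move=> /FixP fF; have fs := frob_dvd r_s fF.
by rewrite /tau -frob_comp !fs (addxx cardK).
Qed.

(** For f fixed by frob s, the value chi of cubic_char_theta is taken at
f^3 (c + frob s c), and chi does not notice frob s. *)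
Lemma cubic_char_half_space : {in U, forall x, cubic_char s 1 x = 1}.
Proof.
move=> _ /half_spaceP[x [f [xF fF ->]]]; have fe := r_sub fF.
rewrite (cubic_charD cardK) polar_char_half ?tau_base ?expr0n // mulr1.
have -> : cubic_char s 1 x = 1.
  apply: psi_half; rewrite /cubic mul1r.
  by rewrite (FixD cardK) // FixM ?FixX ?Fix_frob.
rewrite mul1r cubic_char_theta // (frob_dvd r_s (FixP _ _ fF)).
have /NullP[_ <-] := Null_frob s (FixM (FixX 3 fe) norm_theta_in).
congr chi; rewrite frobM frobX (frob_dvd r_s (FixP _ _ fF)) shift_sqr.
rewrite /norm_theta; move: (frob s theta) => t'; ring2 cardK.
Qed.

(** The set Q collects representatives k such that the cosets of theta k exhaust the
orthogonal of the half space; the bound on the radical ensures this through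
card_perp_le. *)
Lemma cubic_sum_half (Q : {set K}) : Q \subset Fix e ->
    {in Q, forall k, tau s k ^+ 4 = tau s k} ->
    {in Q & Fix r, forall k f, polar_char s 1 (theta * k) (theta * f) = 1} ->
    {in Q &, forall k l, k + l \in Fix r -> k = l} ->
    (#|radical (2 * e) s (1%R : K)| <= #|Q| * 2 ^ (2 * r))%N ->
  cubic_sum (2 * e) s (1 : K)
    = (2 ^ (e + r))%N%:Z * \sum_(k in Q) cubic_char s 1 (theta * k).
Proof.
move=> QF Q_tau Q_perp Q_inj rad_le.
have theta0 : theta != 0.
  by apply: contra_eqN theta_bar => /eqP ->; rewrite frob_0 add0r eq_sym
    oner_eq0.
have th_inj : injective ( *%R theta) by apply: mulfI.
have KE x : x \in Fix (2 * e) by rewrite (FixN cardK) inE.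
have Kz := Fix_zmod cardK (2 * e).
have UK : U \subset Fix (2 * e) by apply/subsetP => y _.
pose T := [set theta * k | k in Q].
have cardT : #|T| = #|Q| by rewrite card_imset.
rewrite /cubic_sum (sum_isotropic_cosets (@cubic_char_sqr K s 1) (cubic_charD
  cardK s 1)
  (polar_charDl cardK s 1) Kz half_space_zmod UK cubic_char_half_space (T :=
    T)).
- by rewrite card_half_space -expnD big_imset //= => k l _ _ /th_inj.
- apply/subsetP => _ /imsetP[k kQ ->]; apply/perpP; split=> //.
  move=> _ /half_spaceP[x [f [xF fF ->]]].
  rewrite (polar_charDl cardK) (polar_char_half xF (subsetP QF k kQ) (Q_tau k
    kQ)) mul1r.
  by rewrite /polar_char polarC -/(polar_char _ _ _ _) Q_perp.
- move=> _ _ /imsetP[k kQ ->] /imsetP[l lQ ->].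
  rewrite (opp2 cardK) -mulrDr => /half_spaceP[x [f [xF fF eq]]].
  congr (theta * _); apply: Q_inj => //.
  have klF : k + l \in Fix e by rewrite (FixD cardK) ?(subsetP QF).
  have := half_space_bar xF (r_sub fF); rewrite -eq -[theta * _]add0r.
  by rewrite half_space_bar ?Fix0 // => ->.
have := card_perp_le (@cubic_char_sqr K s 1) (cubic_charD cardK s 1)
  (polar_charDl cardK s 1) Kz half_space_zmod UK.
rewrite (FixN cardK) cardsT cardK -(FixN cardK) => le1.
rewrite cardT -(leq_pmul2l (_ : 0 < #|U|)%N); last by rewrite card_half_space
  muln_gt0 !expn_gt0.
apply: leq_trans le1 _; apply: leq_trans (leq_mul (leqnn _) rad_le) _.
rewrite card_half_space !mul2n -!addnn !expnD.
by apply: eq_leq; ring.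
Qed.

End QuadraticExtension.

Section OddR.
Variables (K : finFieldType) (r n : nat).
Implicit Types (x y z k l : K).
Hypotheses (r_gt0 : (0 < r)%N) (n_gt0 : (0 < n)%N) (r_odd : odd r).

(** For odd n, a primitive cube root of unity serves as theta.  The radical is
Fix (2 * r), so small that the half space is its own orthogonal. *)
Lemma cubic_sum_2mod4 : #|K| = (2 ^ (2 * (r * n)))%N -> odd n ->
  cubic_sum (2 * (r * n)) r (1 : K) = 2 ^+ (r * n.+1).
Proof.
move=> cardK n_odd; have e_gt0 : (0 < r * n)%N by rewrite muln_gt0 r_gt0.
have N_gt0 : (0 < 2 * (r * n))%N by rewrite muln_gt0.
have N_even : ~~ odd (2 * (r * n)) by rewrite oddM.
have [om om_eq] := exists_omega cardK N_even.
have fom : frob 1 om = om + 1 by rewrite frob1.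
have om_bar : frob (r * n) om = om + 1.
  by rewrite -[(r * n)%N]mul1n (frob_shift cardK (r * n) (frob_1 K 1) fom) oddM
    r_odd n_odd.
have rad : #|radical (2 * (r * n)) r (1%R : K)| = (2 ^ (2 * r))%N.
  rewrite (card_radical_trivial cardK) ?frob_1 ?oner_neq0 //.
    by rewrite addnn -mul2n (gcdn_idPl _) // dvdn_pmul2l // dvdn_mulr.
  move=> y ty; apply: (tau_fixed_eq0 cardK n_odd) => //.
    by rewrite addnn -mul2n -mulnA.
  by apply: (cube_root_fixed cardK (b := 1) _ _ (oner_neq0 K) N_even ty);
    rewrite ?frob_1 ?expr1n.
have t0 : tau r (0 : K) = 0 by rewrite /tau frob_0 addr0.
have := cubic_sum_half cardK e_gt0 om_bar r_gt0 (dvdn_mulr _ (dvdnn r)) (dvdnn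
  r) (Q := [set 0]).
rewrite big_set1 cards1 mul1n rad mulr0 => ->.
- by rewrite cubic_char0 mulr1 -natz natrX mulnS addnC.
- by rewrite sub1set Fix0.
- by move=> k /set1P ->; rewrite t0 expr0n.
- by move=> k f /set1P -> _; rewrite mulr0 polar_char0.
- by move=> k l /set1P -> /set1P ->.
- by [].
Qed.

End OddR.

(** * Odd r and n divisible by four *)

Section FourDivides.
Variables (K : finFieldType) (r e j : nat).
Implicit Types (x y z k l f : K).
Local Notation s := (1 + 4 * j)%N.
Hypothesis cardK : #|K| = (2 ^ (2 * e))%N.
Hypotheses (e_gt0 : (0 < e)%N) (r_odd : odd r).
Hypotheses (r_e : (r %| e)%N) (r_s : (r %| s)%N).
Hypothesis gcd_s : gcdn (s + s) (2 * e) = (2 * r)%N.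
Let r_gt0 : (0 < r)%N. Proof. by case: (r) r_odd. Qed.
Variables t om : K.
Hypotheses (t2 : t ^+ 2 = t + om) (om2 : om ^+ 2 = om + 1).

Lemma t4 : t ^+ 4 = t + 1.
Proof. by rewrite (exprM t 2 2) t2 (sqrD2 cardK) t2 om2; ring2 cardK. Qed.

Lemma omE : om = t ^+ 2 + t.
Proof. by rewrite t2; ring2 cardK. Qed.

Lemma t_Fix4 : t \in Fix 4.
Proof.
apply/FixP; rewrite frobE (exprM t 4 4) t4; ring2_with cardK t4.
Qed.
Let fr4t : frob 4 t = t. Proof. exact/FixP/t_Fix4. Qed.

Lemma frob_s_t : frob s t = t ^+ 2.
Proof. by rewrite -frob_comp (frob_mul _ fr4t) frob1. Qed.

Lemma frob_s_om : frob s om = om ^+ 2.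
Proof. by rewrite omE (frobD cardK) frobX frob_s_t (sqrD2 cardK). Qed.

Lemma om_Fix4 : om \in Fix 4.
Proof. by rewrite omE (FixD cardK) ?FixX ?t_Fix4. Qed.

Lemma tau_t : tau s t = 1.
Proof.
by rewrite /tau -frob_comp frob_s_t frobX frob_s_t -exprM t4; ring2 cardK.
Qed.

Lemma tau_om : tau s om = 0.
Proof. by rewrite /tau (frob2_om cardK om2) (addxx cardK). Qed.

Lemma card_radical_t : #|radical (2 * e) s (1%R : K)| = (4 * 2 ^ (2 * r))%N.
Proof.
rewrite -gcd_s; apply: (card_radical_full cardK _ om2 (y0 := t)); rewrite
  ?frob_1 ?oner_neq0 //.
- by rewrite muln_gt0.
- by rewrite tau_t oner_neq0.
- by rewrite tau_t expr1n mulr1.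
Qed.

(** The element om t lies in the radical since tau sends it to om.  The form takes
the value om t + om + 1 there, whose trace from F_16 to F_2 is 1; as K has odd
degree over F_16, psi is -1 at this value. *)
Lemma cubic_sum_vanishes : (2 * 2 %| 2 * e)%N -> odd (2 * e %/ 4) ->
  cubic_sum (2 * e) s (1 : K) = 0.
Proof.
move=> dvd4 odd4; have N_gt0 : (0 < 2 * e)%N by rewrite muln_gt0.
have tau_omt : tau s (om * t) = om.
  by rewrite /tau frobM (frob2_om cardK om2) -frob_comp frob_s_t frobX frob_s_t
    -exprM t4; ring2 cardK.
have om3 := om3 cardK om2.
have omt_rad : om * t \in radical (2 * e) s 1.
  by rewrite (in_radical cardK N_gt0) ?frob_1 ?oner_neq0 // tau_omt mul1r
    (exprS _ 3) om3 mulr1.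
have char_omt : cubic_char s 1 (om * t) != 1.
  apply/eqP => /psiP[z].
  have -> : cubic s 1 (om * t) = om * t + om + 1.
    rewrite /cubic mul1r frobM frob_s_om frob_s_t.
    transitivity (om ^+ 3 * om ^+ 2 * t ^+ 4 * t + om ^+ 3 * om * t ^+ 4).
      by ring.
    rewrite om3 om2 t4.
    transitivity ((om + 1) * (t ^+ 2 + t) + om * t + om); first by ring.
    by rewrite -omE; ring2_with cardK om2.
  move=> zc; have zF : z \in Fix 4.
    apply: (AS_odd_degree cardK (e := 4)) => //.
    by rewrite zc !(FixD cardK) ?FixM ?t_Fix4 ?om_Fix4 ?Fix1.
  have fr2E (y : K) : frob 2 y = (y ^+ 2) ^+ 2 by rewrite -(frob_comp 1 1)
    !frob1.
  have fr2t : frob 2 t = t + 1 by rewrite fr2E -exprM t4.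
  have fr2om : frob 2 om = om by rewrite (frob2_om cardK om2 1).
  (* z + frob 4 z is the trace of z^2 + z from F_16 to F_2; it is computed
     through F_4. *)
  pose y := z + frob 2 z; have y2 : y ^+ 2 = y + om.
    apply: (add2_eq0 cardK); rewrite /y (sqrD2 cardK) -frobX.
    transitivity ((z ^+ 2 + z) + frob 2 (z ^+ 2 + z) + om); first by rewrite
      (frobD cardK); ring.
    by rewrite zc (frobD cardK _ (om * t + om)) (frobD cardK _ (om * t)) frob_1
      frobM fr2om fr2t; ring2 cardK.
  have : z + frob 4 z = 1.
    have -> : z + frob 4 z = y + frob 2 y.
      by rewrite /y (frobD cardK) frob_comp /=; move: (frob 2 z) (frob _ z) =>
        u v; ring2 cardK.
    by rewrite fr2E y2 (sqrD2 cardK) y2 om2; ring2 cardK.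
  by rewrite (FixP _ _ zF) (addxx cardK) => /eqP; rewrite eq_sym oner_eq0.
have := cubic_sum_sqr cardK (2 * e) s 1.
rewrite (_ : [forall x in _, _] = false); last first.
  by apply: contraNF char_omt => /forall_inP/(_ _ omt_rad).
by rewrite !mulr0 => /eqP; rewrite expf_eq0 => /eqP.
Qed.

Section EightDivides.

Hypothesis four_e : (4 %| e)%N.
Variable theta : K.
Hypothesis theta_bar : frob e theta = theta + 1.
Local Notation c := (norm_theta theta).
Local Notation d := (theta + frob s theta).
Local Notation Null := (Null e theta).

Let cF : c \in Fix e. Proof. exact: norm_theta_in. Qed.
Let dF : d \in Fix e. Proof. exact: shift_in. Qed.
Let tF : t \in Fix e. Proof. exact: (Fix_dvd four_e t_Fix4). Qed.
Let omF : om \in Fix e. Proof. by rewrite omE (FixD cardK) // FixX. Qed.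
Let nullD := NullD cardK (theta := theta).
Let null_fr := Null_frob cardK e_gt0 theta_bar.
Let null_sq := Null_sq cardK e_gt0 theta_bar.

(** Here theta + frob 4 theta = c + c^2 + c^4 + c^8.  Moving each Frobenius power
from c to v turns chi of the product into chi of c times the trace of v, which
vanishes. *)
Lemma Null_trace v : v \in Fix 4 -> v + frob 1 v + frob 2 v + frob 3 v = 0 ->
  v * (theta + frob 4 theta) \in Null.
Proof.
move=> v4 v_tr; have vF i : frob i v * c \in Fix e.
  by rewrite FixM // Fix_frob // (Fix_dvd four_e).
have fr4v : frob 4 v = v by apply/FixP.
have v_sum : v = frob 1 v + frob 2 v + frob 3 v.
  by apply: (add2_eq0 cardK); rewrite -[RHS]v_tr; ring.
have -> : v * (theta + frob 4 theta)
    = (frob 3 v * c + frob 1 (frob 3 v * c)) + (frob 2 v * c + frob 2 (frob 2 v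
      * c))
      + (frob 1 v * c + frob 3 (frob 1 v * c)).
  rewrite !frobM !frob_comp !addnE /= fr4v /norm_theta !(frobD cardK) -!frob1
    !frob_comp !addnE /=.
  rewrite {1}v_sum; move: (frob 1 v) (frob 2 v) (frob 3 v) v_sum => v1 v2 v3 ->.
  ring2 cardK.
by apply: nullD; [apply: nullD|]; apply: null_fr.
Qed.

(** As frob s = frob (1 + 4 j), the element c + d is the square of
theta + frob (4 j) theta, a sum of j conjugates of theta + frob 4 theta under
powers of frob 4, and these fix v. *)
Lemma Null_shift v : v \in Fix 4 -> v + frob 1 v + frob 2 v + frob 3 v = 0 ->
  v ^+ 2 * (c + d) \in Null.
Proof.
move=> v4 v_tr; have fr4v : frob 4 v = v by apply/FixP.
have vF : v \in Fix e by apply: (Fix_dvd four_e).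
have thF i : theta + frob i theta \in Fix e.
  by apply: shift_in.
have main i : v * (theta + frob (4 * i) theta) \in Null.
  elim: i => [|i IH].
    by rewrite muln0 frob0 (addxx cardK) mulr0 -[0](addxx cardK 0) -{2}(frob_0
      K 0) null_fr ?Fix0.
  have -> : v * (theta + frob (4 * i.+1) theta) = v * (theta + frob (4 * i)
    theta)
     + (v * (theta + frob 4 theta) + (v * (theta + frob 4 theta)
        + frob (4 * i) (v * (theta + frob 4 theta)))).
    rewrite frobM (frob_mul _ fr4v) (frobD cardK _ theta) frob_comp mulnSr.
    by move: (frob _ theta) (frob (4 * i + 4) theta) => x y; ring2 cardK.
  by rewrite nullD // nullD ?Null_trace // null_fr // FixM.
have -> : v ^+ 2 * (c + d) = v * (theta + frob (4 * j) theta) +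
    (v * (theta + frob (4 * j) theta) + (v * (theta + frob (4 * j) theta)) ^+
      2).
  rewrite /norm_theta -frob_comp frob1 exprMn (sqrD2 cardK).
  by move: (frob _ theta) => x; ring2 cardK.
by rewrite nullD // null_sq // FixM.
Qed.

Let Null_cd : c + d \in Null.
Proof.
have := @Null_shift 1; rewrite expr1n mul1r; apply; first exact: Fix1.
by rewrite !frob_1; ring2 cardK.
Qed.

Let Null_tcd : t ^+ 2 * (c + d) \in Null.
Proof.
apply: Null_shift; first exact: t_Fix4.
have fr2t : frob 2 t = t + 1 by rewrite frobE t4.
rewrite -(frob_comp 1 2) fr2t (frobD cardK) frob_1 frob1; ring2 cardK.
Qed.

Let Null1 : 1 \in Null.
Proof.
have -> : 1 = om + om ^+ 2 by rewrite om2; ring2 cardK.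
exact: null_sq.
Qed.

Let Null_t2 : t ^+ 2 \in Null.
Proof.
have t_om : t * om = om * t by rewrite mulrC.
have -> : t ^+ 2 = (om * t ^+ 2 + t + 1) + (om * t ^+ 2 + t + 1) ^+ 2.
  rewrite !(sqrD2 cardK) exprMn -exprM om2 t4 expr1n t2.
  by ring2_with cardK om2.
by rewrite null_sq // !(FixD cardK) ?FixM ?FixX ?Fix1.
Qed.

(** Up to elements of Null, the argument of chi in cubic_char_theta is c, where chi
is -1. *)
Lemma cubic_char_theta_om : cubic_char s 1 (theta * om) = -1.
Proof.
have <- := chi_norm_theta cardK theta_bar.
rewrite (cubic_char_theta cardK e_gt0 theta_bar _ omF) frob_s_om.
have nP := null_fr s (FixM omF cF).
transitivity (chi theta (c + (c + d + 1 + (om * c + frob s (om * c))))); last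
  first.
  rewrite (chiD cardK); have /NullP[_ ->] := nullD (nullD Null_cd Null1) nP.
  by rewrite mulr1.
congr chi.
rewrite frobM frob_s_om (shift_sqr cardK) om2.
move: c d => u v; ring2_with cardK om2.
Qed.

Lemma cubic_char_theta_t : cubic_char s 1 (theta * t) = -1.
Proof.
have <- := chi_norm_theta cardK theta_bar.
rewrite (cubic_char_theta cardK e_gt0 theta_bar _ tF) frob_s_t.
have nP := null_fr s (FixM (FixX 2 omF) cF).
transitivity (chi theta (c + (t ^+ 2 * (c + d) + (c + d)
   + (t ^+ 2 + 1) + (om ^+ 2 * c + frob s (om ^+ 2 * c))))); last first.
  rewrite (chiD cardK).
  have /NullP[_ ->] := nullD (nullD (nullD Null_tcd Null_cd) (nullD Null_t2
    Null1)) nP.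
  by rewrite mulr1.
congr chi; rewrite frobM frobX frob_s_om (shift_sqr cardK).
have -> : t * (t ^+ 2) ^+ 2 = om by rewrite -exprM t4 mulrDr mulr1 -expr2 omE.
have -> : t ^+ 2 * t ^+ 2 = t + 1 by rewrite -expr2 -exprM t4.
have -> : (om ^+ 2) ^+ 2 = om by rewrite om2 (sqrD2 cardK) om2; ring2 cardK.
rewrite om2 t2; move: c d => u v; ring2 cardK.
Qed.

(** Squaring the argument does not change cubic_char, and
(theta t)^2 = theta t^2 + c t^2, where the last term lies in Fix e. *)
Lemma cubic_char_theta_t2 : cubic_char s 1 (theta * t ^+ 2) = -1.
Proof.
rewrite -cubic_char_theta_t.
have -> : cubic_char s 1 (theta * t) = cubic_char s 1 ((theta * t) ^+ 2).
  rewrite /cubic_char -[LHS](psi_frob cardK 1); congr psi.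
  by rewrite /cubic !mul1r frob1 (sqrD2 cardK) !frobX; ring.
have -> : (theta * t) ^+ 2 = c * t ^+ 2 + theta * t ^+ 2.
  by rewrite /norm_theta exprMn; ring2 cardK.
have ctF : c * t ^+ 2 \in Fix e by rewrite FixM ?FixX.
rewrite (cubic_charD cardK) (polar_char_half cardK e_gt0 theta_bar ctF) ?FixX
  //; last first.
  by rewrite /tau frobX -(sqrD2 cardK) -/(tau s t) tau_t !expr1n.
rewrite mulr1; have -> : cubic_char s 1 (c * t ^+ 2) = 1; last by rewrite mul1r.
apply: (psi_half cardK e_gt0); rewrite /cubic mul1r.
by rewrite (FixD cardK) // FixM ?FixX ?Fix_frob.
Qed.

Lemma polar_char_theta_om f :
  f \in Fix r -> polar_char s 1 (theta * om) (theta * f) = 1.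
Proof.
move=> fFr; have fF := Fix_dvd r_e fFr; have fs := frob_dvd r_s (FixP _ _ fFr).
rewrite (polar_char_theta cardK e_gt0 theta_bar _ omF fF) frob_s_om fs.
(* The argument of chi is the sum of the following four elements. *)
have n1 := null_sq fF.
have n2 := null_sq (FixM fF dF).
have n3 := null_fr s (FixM (FixX 2 fF) cF).
have n4 := null_fr s (FixM (FixM (FixD cardK fF (FixX 2 fF)) (FixX 2 omF)) cF).
have /NullP[_ <-] := nullD (nullD n1 n2) (nullD n3 n4); congr chi.
rewrite !(frobM, frobX) !(frobD cardK _ f) frobX fs frob_s_om (shift_sqr cardK)
  om2.
move: c d => u v; ring2_with cardK om2.
Qed.

Lemma polar_char_theta_t f :
  f \in Fix r -> polar_char s 1 (theta * t) (theta * f) = 1.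
Proof.
move=> fFr; have fF := Fix_dvd r_e fFr; have fs := frob_dvd r_s (FixP _ _ fFr).
rewrite (polar_char_theta cardK e_gt0 theta_bar _ tF fF) frob_s_t fs.
have gF := FixD cardK fF (FixX 2 fF).
(* The argument of chi is the sum of the following seven elements. *)
have n1 := null_sq (FixM (FixX 2 omF) fF).
have n2 := null_sq (FixM (FixM dF omF) fF).
have n3 := null_fr s (FixM (FixM omF (FixX 2 fF)) cF).
have n4 := null_sq (FixM fF dF).
have n5 := null_fr s (FixM (FixX 2 fF) cF).
have n6 := null_fr s (FixM (FixM cF (FixD cardK (FixX 2 tF) (Fix1 K e))) gF).
have n7 := null_fr s (FixM cF fF).
have /NullP[_ <-] := nullD (nullD (nullD n1 n2) (nullD n3 n4)) (nullD (nullD n5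
  n6) n7).
congr chi.
rewrite !(frobM, frobX) !(frobD cardK _ f) (frobD cardK _ (t ^+ 2)) frob_1
  !frobX fs frob_s_om frob_s_t (shift_sqr cardK) om2.
rewrite -[(t ^+ 2) ^+ 2]exprM t4 t2.
move: c d => u v; ring2_with cardK om2.
Qed.

(** The four cosets of the half space U represented by 0, theta om, theta t and
theta t^2 form its orthogonal, and they contribute |U| (1 - 1 - 1 - 1). *)
Lemma cubic_sum_negative : cubic_sum (2 * e) s (1 : K) = - 2 ^+ (e + r + 1).
Proof.
have om_neq0 := om_neq0 om2.
have tau0 : tau s (0 : K) = 0 by rewrite /tau frob_0 addr0.
pose Q := [set 0; om; t; t ^+ 2].
have om1 : om != 1.
  by apply/eqP => o1; move: om2; rewrite o1 expr1n (addxx cardK) => /eqP;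
    rewrite oner_eq0.
have t0 : t != 0 by apply: contraNneq om_neq0 => t_0; rewrite omE t_0 expr0n
  addr0.
have notin_base x : x \in [:: om; t; t ^+ 2] -> x \in @Fix K r -> False.
  move=> xQ /FixP/(frob_dvd r_s); move: xQ; rewrite !inE => /or3P[]/eqP ->.
  - by rewrite frob_s_om om2 -{2}[om]addr0 => /addrI/eqP; rewrite oner_eq0.
  - by rewrite frob_s_t t2 -{2}[t]addr0 => /addrI/eqP; rewrite (negPf om_neq0).
  - by rewrite frobX frob_s_t -exprM t4 t2 => /addrI/esym/eqP; rewrite (negPf
    om1).
have om_t : om != t.
  by apply/eqP => eq; move: om2; rewrite eq t2 eq => /addrI/eqP; rewrite -eq
    (negPf om1).
have om_tt : om != t ^+ 2.
  by rewrite t2 -{1}[om]add0r (inj_eq (addIr om)) eq_sym.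
have t_tt : t != t ^+ 2.
  by rewrite t2 -{1}[t]addr0 (inj_eq (addrI t)) eq_sym.
have tt0 : t ^+ 2 != 0 by rewrite expf_neq0.
have Q_cases (P : K -> Prop) : P 0 -> P om -> P t -> P (t ^+ 2) -> {in Q,
  forall k, P k}.
  by move=> ? ? ? ? k; rewrite !inE -!orbA => /or4P[] /eqP ->.
have QE : \sum_(k in Q) cubic_char s 1 (theta * k) = -2.
  rewrite /Q -!setUA !big_setU1 ?big_set1 ?inE ?negb_or ?om_t ?om_tt ?t_tt //=.
    rewrite mulr0 cubic_char_theta_om cubic_char_theta_t cubic_char_theta_t2.
    by rewrite cubic_char0.
  by rewrite !(eq_sym 0) om_neq0 t0 tt0.
have cardQ : #|Q| = 4%N.
  rewrite /Q -!setUA !cardsU1 cards1 !inE !negb_or om_t om_tt t_tt.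
  by rewrite !(eq_sym 0) om_neq0 t0 tt0.
rewrite (cubic_sum_half cardK e_gt0 theta_bar r_gt0 r_e r_s (Q := Q)) ?QE.
- by rewrite -[Posz (2 ^ _)]natz natrX mulrN [in RHS]exprD.
- apply/subsetP; apply: Q_cases; by rewrite ?Fix0 ?FixX.
- have tau_tt : tau s (t ^+ 2) = 1.
    by rewrite /tau frobX -(sqrD2 cardK) -/(tau s t) tau_t expr1n.
  by apply: Q_cases; rewrite ?tau0 ?tau_om ?tau_t ?tau_tt ?expr1n ?expr0n.
- move=> k f kQ fF; move: k kQ; apply: Q_cases.
  + by rewrite mulr0 polar_char0.
  + exact: polar_char_theta_om.
  + exact: polar_char_theta_t.
  + rewrite t2 mulrDr (polar_charDl cardK) polar_char_theta_t //
    polar_char_theta_om //.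
- move=> k l kQ lQ klF; apply: (add2_eq0 cardK).
  have QD : {in Q, forall k, {in Q, forall l, k + l \in Q}}.
    have memQ x : [\/ x = 0, x = om, x = t | x = t + om] -> x \in Q.
      by rewrite !inE t2 => -[] ->; rewrite eqxx ?orbT.
    apply: (Q_cases _); apply: (Q_cases _); apply: memQ; rewrite ?t2;
      first [ apply: Or41; ring2 cardK | apply: Or42; ring2 cardK
            | apply: Or43; ring2 cardK | apply: Or44; ring2 cardK ].
  have : k + l \in Q by apply: QD.
  move: (k + l) klF => x xF xQ; move: x xQ xF.
  by apply: Q_cases => // /notin_base []; rewrite !inE eqxx ?orbT.
- by rewrite card_radical_t cardQ.
Qed.

End EightDivides.

End FourDivides.

(** * Counting the points of the curve *)

Section Reductions.
Variables (K : finFieldType) (N : nat).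
Implicit Types (a b x y : K).
Hypothesis cardK : #|K| = (2 ^ N)%N.

(** The fibre over x has 1 + psi (f x) points. *)
Lemma card_AS_curve (f : K -> K) :
  #|[set p : K * K | p.2 ^+ 2 + p.2 == f p.1]|%:Z
    = (2 ^ N)%N%:Z + \sum_x psi (f x).
Proof.
rewrite -cardK -sum1dep_card -[Posz _]natz natr_sum.
rewrite -(pair_big_dep xpredT (fun x y => y ^+ 2 + y == f x) (fun _ _ => 1)) /=.
rewrite -sum1_card -[X in X + _]natz natr_sum -big_split /=.
apply: eq_bigr => x _; rewrite -(card_AS_fiber cardK) -[RHS]natz -sum1dep_card
  natr_sum.
by [].
Qed.

Lemma cubic_sumE s a : cubic_sum N s a = \sum_(x : K) cubic_char s a x.
Proof. by apply: eq_bigl => x; rewrite (FixN cardK) in_setT. Qed.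

(** Substitute b x for x. *)
Lemma cubic_sum_cube s a b : a = b ^+ 3 -> frob s b = b -> b != 0 ->
  cubic_sum N s a = cubic_sum N s (1 : K).
Proof.
move=> -> fb b0; rewrite !cubic_sumE [RHS](reindex_inj (mulfI b0)) /=.
apply: eq_bigr => x _; congr psi; rewrite /cubic frobM fb; ring.
Qed.

(** Up to the Frobenius power frob s, the form is symmetric in frob s and its
inverse. *)
Lemma cubic_sum_inverse s : (s <= N)%N ->
  cubic_sum N s (1 : K) = cubic_sum N (N - s) (1 : K).
Proof.
move=> sN; rewrite !cubic_sumE; apply: eq_bigr => x _.
transitivity (psi (frob s (cubic (N - s) 1 x))); last exact: (psi_frob cardK).
congr psi; rewrite /cubic !mul1r (frobD cardK) !(frobX, frobM) frob_comp subnKC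
  // (frobN cardK).
ring.
Qed.

End Reductions.

Section FourDividesN.
Variables (K : finFieldType) (r m : nat).
Hypotheses (r_odd : odd r) (m_gt0 : (0 < m)%N) (m_even : ~~ odd m).
Hypothesis cardK : #|K| = (2 ^ (2 * (r * m)))%N.
Let r_gt0 : (0 < r)%N. Proof. by case: (r) r_odd. Qed.
Let e_gt0 : (0 < r * m)%N. Proof. by rewrite muln_gt0 r_gt0. Qed.

(** An element t with t^4 = t + 1, which generates F_16; then om = t^2 + t. *)
Lemma exists_quartic : exists t om : K, t ^+ 2 = t + om /\ om ^+ 2 = om + 1.
Proof.
have dvd : (2 * 2 %| 2 * (r * m))%N by rewrite dvdn_pmul2l // dvdn_mull //
  dvdn2.
have [t _ eq] := trace_onto cardK (isT : 0 < 2)%N dvd (Fix1 K 2).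
exists t, (t ^+ 2 + t); split; first by ring2 cardK.
rewrite (sqrD2 cardK) -eq -exprM -(frobE 2); ring2 cardK.
Qed.

(** For r = 3 modulo 4 the inverse of frob r replaces it.  In both cases
frob s with s = 1 + 4 j acts on F_16 as squaring. *)
Lemma generator_1mod4 : exists j,
  [/\ (r %| 1 + 4 * j)%N,
      gcdn (1 + 4 * j + (1 + 4 * j)) (2 * (r * m)) = (2 * r)%N
    & cubic_sum (2 * (r * m)) r (1 : K)
      = cubic_sum (2 * (r * m)) (1 + 4 * j) (1 : K)].
Proof.
have r_e : (r * 1 <= 2 * (r * m))%N by rewrite mulnCA leq_pmul2l // muln_gt0.
rewrite muln1 in r_e.
have [/eqP r1|/eqP r3] : (r %% 4 == 1)%N \/ (r %% 4 == 3)%N by lia.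
  exists (r %/ 4)%N; rewrite (_ : 1 + 4 * (r %/ 4) = r)%N; last by lia.
  split=> //; rewrite addnn -mul2n; apply/gcdn_idPl.
  by rewrite dvdn_pmul2l // dvdn_mulr.
exists ((2 * (r * m) - r) %/ 4)%N.
have m2 : (m = 2 * m./2)%N by lia.
have sE : (1 + 4 * ((2 * (r * m) - r) %/ 4) = 2 * (r * m) - r)%N.
  have -> : (2 * (r * m) = 4 * (r * m./2))%N by rewrite {1}m2; lia.
  by lia.
rewrite sE; split.
- by rewrite dvdn_sub // mulnCA dvdn_mulr.
- rewrite (_ : 2 * (r * m) - r = r * (2 * m - 1))%N; last by rewrite mulnBr
  muln1 mulnCA.
  rewrite addnn -mul2n !mulnA -muln_gcdr gcdnC.
  rewrite (_ : 2 * m - 1 = m + m.-1)%N; last by lia.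
  by rewrite gcdnDl (eqP (coprimenP m_gt0)) muln1.
- exact: (cubic_sum_inverse cardK).
Qed.

Lemma cubic_sum_4mod8 : odd m./2 -> cubic_sum (2 * (r * m)) r (1 : K) = 0.
Proof.
move=> odd_m2; have [t [om [t2 om2]]] := exists_quartic.
have [j [r_s gcd_s ->]] := generator_1mod4.
have m2 : (m = 2 * m./2)%N by lia.
apply: (cubic_sum_vanishes j cardK e_gt0 t2 om2).
  by rewrite dvdn_pmul2l // dvdn_mull // dvdn2.
rewrite m2 (_ : 2 * (r * (2 * m./2)) = r * m./2 * 4)%N; last by lia.
by rewrite mulnK // oddM r_odd.
Qed.

Lemma cubic_sum_0mod8 : ~~ odd m./2 ->
  cubic_sum (2 * (r * m)) r (1 : K) = - 2 ^+ (r * m.+1 + 1).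
Proof.
move=> even_m2; have [t [om [t2 om2]]] := exists_quartic.
have [j [r_s gcd_s ->]] := generator_1mod4.
have [theta _ eq] := trace_onto cardK e_gt0 (dvdnn _) (Fix1 K _).
have theta_bar : frob (r * m) theta = theta + 1 by rewrite -eq; ring2 cardK.
have four_e : (4 %| r * m)%N by rewrite dvdn_mull //; lia.
rewrite (cubic_sum_negative cardK e_gt0 r_odd (dvdn_mulr _ (dvdnn r)) r_s gcd_s
  t2 om2 four_e theta_bar).
by rewrite mulnSr.
Qed.

End FourDividesN.

Lemma C2_count_cubic_sum (r n : nat) (F K : finFieldType)
    (iota : {rmorphism F -> K}) (alpha : F) : #|K| = (2 ^ (r * n))%N ->
  (C2_count r iota alpha)%:Z
    = 2 ^+ (r * n) + 1 + cubic_sum (r * n) r (iota alpha).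
Proof.
move=> cardK; rewrite /C2_count PoszD.
have -> : C2_affine r iota alpha
    = [set p : K * K | p.2 ^+ 2 + p.2 == cubic r (iota alpha) p.1].
  have monomials (x : K) : x * frob r x ^+ 2 + x ^+ 2 * frob r x
      = x ^+ (2 ^ (r + 1) + 1)%N + x ^+ (2 ^ r + 2)%N.
    by rewrite frobE !exprD expnD exprM expr1; ring.
  by apply/setP => p; rewrite !inE /cubic monomials.
rewrite (card_AS_curve cardK) -(cubic_sumE cardK) -natz natrX; ring.
Qed.

Theorem theorem6 (r n : nat) (F K : finFieldType) (iota : {rmorphism F -> K})
    (alpha : F)
    (hr : (1 <= r)%N) (hn : (1 <= n)%N)
    (hF : #|F| = (2 ^ r)%N) (hK : #|K| = (2 ^ (r * n))%N)
    (halpha : alpha != 0) :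
  let N : int := (C2_count r iota alpha)%:Z in
  let q1 : int := 2 ^+ (r * n)%N + 1 in
  (odd r ->
    [/\ (n = 1 %[mod 8] \/ n = 7 %[mod 8] ->
           N = q1 + 2 ^+ (r * (n + 1) %/ 2)%N),
        (n = 3 %[mod 8] \/ n = 5 %[mod 8] ->
           N = q1 - 2 ^+ (r * (n + 1) %/ 2)%N),
        (n = 2 %[mod 8] \/ n = 6 %[mod 8] ->
           N = q1 + 2 ^+ (r * (n + 2) %/ 2)%N),
        (n = 4 %[mod 8] -> N = q1)
      & (n = 0 %[mod 8] ->
           N = q1 - 2 ^+ (r * (n + 2) %/ 2 + 1)%N)])
  /\
  (~~ odd r -> (exists x : F, alpha = x ^+ 3) ->
    [/\ (n = 1 %[mod 4] \/ n = 3 %[mod 4] ->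
           N = q1 + 2 ^+ (r * (n + 1) %/ 2)%N),
        (n = 2 %[mod 4] -> N = q1 + 2 ^+ (r * (n + 2) %/ 2)%N)
      & (n = 0 %[mod 4] ->
           N = q1 - 2 ^+ (r * (n + 2) %/ 2 + 1)%N)])
  /\
  (~~ odd r -> ~ (exists x : F, alpha = x ^+ 3) ->
    [/\ (gcdn n 6 = 1%N -> N = q1 + 2 ^+ (r * (n + 1) %/ 2)%N),
        (gcdn n 6 = 2%N -> N = q1 + 2 ^+ (r * (n + 2) %/ 2)%N),
        (gcdn n 6 = 3%N ->
           N = q1 - 2 ^+ (r * (n + 1) %/ 2 + 1)%N)
      & (gcdn n 6 = 6%N ->
           N = q1 - 2 ^+ (r * (n + 2) %/ 2 + 1)%N)]).
Proof.
move=> N q1; have a0 : iota alpha != 0 by rewrite fmorph_eq0.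
have fr_iota (x : F) : frob r (iota x) = iota x.
  by rewrite frobE -rmorphXn -hF expf_card.
have fa := fr_iota alpha.
have -> : N = q1 + cubic_sum (r * n) r (iota alpha) by apply:
  C2_count_cubic_sum.
have gcd2 : gcdn 2 n = if odd n then 1%N else 2%N.
  case: ifP => on; first by apply/eqP; rewrite -/(coprime 2 n) coprime2n.
  by apply/gcdn_idPl; rewrite dvdn2 on.
split; last split.
- move=> r_odd.
  (* For odd r, 3 divides 2 (2^r - 1) + 1 and alpha^(2^r - 1) = 1. *)
  have [b ab] : exists b : F, alpha = b ^+ 3.
    have [k eqk] : exists k, (k * 3 = (2 ^ r).-1 * 2 + 1)%N.
      exists (((2 ^ r).-1 * 2 + 1) %/ 3)%N; rewrite divnK // /dvdn.
      have : (2 ^ r %% 3 = 2)%N.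
        rewrite -(odd_double_half r) r_odd -mul2n expnD expnM -modnMmr -modnXm.
        by rewrite (_ : 2 ^ 2 %% 3 = 1)%N // exp1n.
      have := expn_gt0 2 r; lia.
    exists (alpha ^+ k); rewrite -exprM eqk exprD exprM expr1.
    have alpha1 : alpha ^+ (2 ^ r).-1 = 1.
      by apply: (mulfI halpha); rewrite mulr1 -exprS prednK ?expn_gt0 // -hF
        expf_card.
    by rewrite alpha1 expr1n mul1r.
  have b0 : iota b != 0 by apply: contraNneq a0 => b0; rewrite ab rmorphXn /=
    b0 expr0n.
  have -> : cubic_sum (r * n) r (iota alpha) = cubic_sum (r * n) r (1 : K).
    by apply: (cubic_sum_cube hK _ (fr_iota b) b0); rewrite ab rmorphXn.
  have odd_case : odd n ->
      cubic_sum (r * n) r (1 : K) = jacobi2 n * 2 ^+ (r * (n + 1) %/ 2)%N.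
    move=> n_odd; rewrite (cubic_sum_odd hr r_odd n_odd hK (dvdnn n)) -divn2
      addn1.
    by rewrite muln_divA // dvdn2 /= n_odd.
  have even_case : ~~ odd n -> exists m, [/\ n = (2 * m)%N, (0 < m)%N,
      (r * n = 2 * (r * m))%N & (r * (n + 2) %/ 2 = r * m.+1)%N].
    move=> n_even; exists n./2; have n2 : n = (2 * n./2)%N by lia.
    split=> //; [by lia | by rewrite {1}n2 mulnCA |].
    by rewrite {1}n2 -mulnSr mulnCA mulKn.
  split=> [n8|n8|n8|n8|n8].
  + rewrite odd_case; last by lia.
    by rewrite /jacobi2 ifT ?mul1r //; lia.
  + rewrite odd_case; last by lia.
    by rewrite /jacobi2 ifF ?mulN1r //; lia.
  + have [m [nm m0 eN ->]] : _ := even_case ltac:(lia).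
    rewrite eN in hK *; rewrite (cubic_sum_2mod4 hr m0 r_odd hK) //; lia.
  + have [m [nm m0 eN _]] : _ := even_case ltac:(lia).
    rewrite eN in hK *; rewrite (cubic_sum_4mod8 r_odd m0 _ hK) ?addr0 //; lia.
  + have [m [nm m0 eN ->]] : _ := even_case ltac:(lia).
    rewrite eN in hK *; rewrite (cubic_sum_0mod8 r_odd m0 _ hK) //; lia.
- move=> r_even [b ab].
  have iab : iota alpha = iota b ^+ 3 by rewrite ab rmorphXn.
  have small := cubic_sum_small_radical hr hn r_even hK a0.
  have large := cubic_sum_large_radical hr hn r_even hK a0.
  rewrite gcd2 in small large.
  have small4 := radical_cube_small hr hn r_even hK fa a0 iab (fr_iota b).
  have large4 := radical_cube_large hr hn r_even hK fa a0 iab (fr_iota b).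
  split=> n4.
  + have on : odd n by lia.
    by rewrite on in small; rewrite small //; apply: small4; lia.
  + have on : odd n = false by lia.
    by rewrite on in small; rewrite small //; apply: small4; lia.
  + have on : odd n = false by lia.
    by rewrite on in large; rewrite large //; apply: large4; lia.
- move=> r_even noncube.
  have [m cardm] : exists m, (3 * m = (2 ^ r).-1)%N.
    exists ((2 ^ r).-1 %/ 3)%N; rewrite mulnC divnK // -subn1 -eqn_mod_dvd
      ?expn_gt0 //.
    rewrite -(odd_double_half r) (negPf r_even) add0n -mul2n expnM -modnXm.
    by rewrite (_ : 2 ^ 2 %% 3 = 1)%N // exp1n.
  have am : iota alpha ^+ m != 1.
    rewrite -rmorphXn fmorph_eq1; apply/eqP => am1; apply: noncube.
    by apply: (@cube_criterion F m); rewrite ?hF.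
  have small := cubic_sum_small_radical hr hn r_even hK a0.
  have large := cubic_sum_large_radical hr hn r_even hK a0.
  rewrite gcd2 in small large.
  have small3 := radical_noncube_small hr hn hK fa a0 cardm am.
  have large3 := radical_noncube_large hr hn r_even hK fa a0 cardm am.
  have gcd6 : gcdn n 6 = ((if odd n then 1 else 2) * (if 3 %| n then 3 else
    1))%N.
    have odd6 : odd n = odd (n %% 6)%N by rewrite odd_mod.
    have dvd6 : (3 %| n)%N = (3 %| n %% 6)%N by lia.
    rewrite -gcdn_modl odd6 dvd6; have := ltn_pmod n (isT : 0 < 6)%N.
    by move: (n %% 6)%N; do 6?[case=> //].
  move: gcd6 small large small3 large3; case: (odd n) => ->.
    case: (3 %| n)%N => small large small3 large3; split=> // _.
    + by rewrite large // large3.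
    + by rewrite small // small3.
  case: (3 %| n)%N => small large small3 large3; split=> // _.
  + by rewrite large // large3.
  + by rewrite small // small3.
Qed.
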